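(* Let $n \geq 2$, and assume that for every convex body $L \subset \mathbb{R}^n$ the Steiner polynomial $S_L$ is stable, i.e. all of its complex roots have strictly negative real part. Let $K \subset \mathbb{R}^n$ be a $C^2$ convex body, let $r_1 \leq r_2 \leq \dots \leq r_n$ be the real parts of the $n$ complex roots of $S_K$ (counted with multiplicity), and let $\rho_{\min}$ and $\rho_{\max}$ denote the minimum and maximum values of the principal radii of curvature of $K$. Then $$-\rho_{\max} \leq r_1 \leq \dots \leq r_n \leq -\rho_{\min}.$$
   Context: A convex body in $\mathbb{R}^n$ is a compact convex subset with nonempty interior. $B$ denotes the closed unit ball of $\mathbb{R}^n$ and, for $t \geq 0$, $K + tB = \{ v + t u \mid v \in K,\ u \in B\}$ is the Minkowski sum. Steiner polynomial: for a convex body $K \subset \mathbb{R}^n$, the $n$-dimensional volume of $K + tB$ is, for $t \geq 0$, a polynomial in $t$ of degree $n$, $$S_K(t) = \mathrm{Vol}_n(K+tB) = \sum_{i=0}^n \binom{n}{i} V(K^{n-i}, B^i)\, t^i,$$ where $V(K^{n-i},B^i)$ is the mixed volume of $n-i$ copies of $K$ and $i$ copies of $B$. This polynomial $S_K$ is the Steiner polynomial of $K$; its roots are taken in $\mathbb{C}$. Support function and principal radii of curvature: the support function of $K$ is $p_K(x) = \sup\{ x \cdot v \mid v \in K\}$ for $x \in \mathbb{R}^n$. A $C^2$ convex body is a convex body whose support function is $C^2$ on $\mathbb{R}^n \setminus \{0\}$. For such $K$ and $\omega \in S^{n-1}$, let $\overline{H}(p_K(\omega))$ be the restriction to the tangent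 space $T_\omega S^{n-1} = \omega^\perp$ of the Hessian of $p_K$ (as a function on $\mathbb{R}^n$) at $\omega$. Its eigenvalues $\rho_1(\omega), \dots, \rho_{n-1}(\omega) \geq 0$ are the principal radii of curvature of $K$ at $\omega$. Then $\rho_{\min}$ and $\rho_{\max}$ are the minimum and maximum of $\rho_i(\omega)$ over all $\omega \in S^{n-1}$ and $1 \leq i \leq n-1$ (so $\rho_{\min} = 0$ is allowed). *)

(* Defs.v *)
From HB Require Import structures.
From mathcomp Require Import all_boot all_order all_algebra.
From mathcomp Require Import all_classical all_reals all_analysis.
From mathcomp Require Import complex.
Set Implicit Arguments.
Unset Strict Implicit.
Unset Printing Implicit Defensive.
Import Order.TTheory GRing.Theory Num.Theory.
Import numFieldNormedType.Exports.
Local Open Scope classical_set_scope.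
Local Open Scope ring_scope.

Section lebesgue_measure_cons.
Context (R : realType) (n : nat).
Local Notation T := (measurableTypeR R).
Variable mu : {sigma_finite_measure set (n.-tuple T) -> \bar R}.

Definition cons_pair (p : T * n.-tuple T) : n.+1.-tuple T :=
  [the n.+1.-tuple T of p.1 :: p.2].

Lemma measurable_cons_pair : measurable_fun [set: T * n.-tuple T] cons_pair.
Proof. exact: measurable_cons. Qed.

Definition lebesgue_cons : set (n.+1.-tuple T) -> \bar R :=
  pushforward (lebesgue_measure \x mu)%E cons_pair.

Let mpreimage (A : set (n.+1.-tuple T)) :
  measurable A -> measurable (cons_pair @^-1` A).
Proof.
by move=> mA; rewrite -[X in measurable X]setTI; exact: measurable_cons_pair.
Qed.

Let lebesgue_cons0 : lebesgue_cons set0 = 0%E.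
Proof. by rewrite /lebesgue_cons /pushforward preimage_set0 measure0. Qed.

Let lebesgue_cons_ge0 A : (0 <= lebesgue_cons A)%E.
Proof. exact: (measure_ge0 (lebesgue_measure \x mu)%E). Qed.

Let lebesgue_cons_sigma_additive : semi_sigma_additive lebesgue_cons.
Proof.
move=> F mF tF mUF; rewrite /lebesgue_cons /pushforward preimage_bigcup.
apply: measure_semi_sigma_additive.
- by move=> k; exact: mpreimage.
- apply/trivIsetP => /= i j _ _ ij; rewrite -preimage_setI.
  by move/trivIsetP : tF => /(_ _ _ _ _ ij) ->//; rewrite preimage_set0.
- by rewrite -preimage_bigcup; exact: mpreimage.
Qed.

HB.instance Definition _ := isMeasure.Build _ _ _ lebesgue_cons
  lebesgue_cons0 lebesgue_cons_ge0 lebesgue_cons_sigma_additive.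

Let lebesgue_cons_sigma_finite : sigma_finite setT lebesgue_cons.
Proof.
have /sigma_finiteP[F [TF ndF Foo]] := sigma_finiteT (@lebesgue_measure R).
have /sigma_finiteP[G [TG ndG Goo]] := sigma_finiteT mu.
pose g (t : n.+1.-tuple T) : T * n.-tuple T := (thead t, [tuple of behead t]).
have mg : measurable_fun setT g.
  by apply: measurable_fun_pair;
     [exact: measurable_tnth|exact: measurable_behead].
have gK p : g (cons_pair p) = p.
  by case: p => x t; rewrite /g /cons_pair/= theadE; congr pair; exact: val_inj.
exists (fun k => g @^-1` (F k `*` G k)).
  apply/seteqP; split=> // t _.
  have [i _ Fi] : (\bigcup_i F i) (g t).1 by rewrite -TF.
  have [j _ Gj] : (\bigcup_j G j) (g t).2 by rewrite -TG.
  exists (maxn i j) => //; split.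
  - by move: (_.1) Fi; exact/subsetPset/ndF/leq_maxl.
  - by move: (_.2) Gj; exact/subsetPset/ndG/leq_maxr.
move=> k; have [mF Fk] := Foo k; have [mG Gk] := Goo k; split.
  by rewrite -[X in measurable X]setTI; apply: mg => //; exact: measurableX.
rewrite /lebesgue_cons /pushforward.
rewrite (_ : _ @^-1` _ = F k `*` G k); last first.
  by apply/funext => p; rewrite -[in RHS](gK p).
by rewrite product_measure1E// lte_mul_pinfty// ge0_fin_numE.
Qed.

HB.instance Definition _ := Measure_isSigmaFinite.Build _ _ _ lebesgue_cons
  lebesgue_cons_sigma_finite.

End lebesgue_measure_cons.

(* n-fold product of [lebesgue_measure]; on R^0 it is the Dirac mass. *)
Fixpoint lebesgue_tuple (R : realType) (n : nat) :
    {sigma_finite_measure set (n.-tuple (measurableTypeR R)) -> \bar R} :=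
  match n with
  | 0 => \d_([tuple] : 0.-tuple (measurableTypeR R))
  | n'.+1 => lebesgue_cons (lebesgue_tuple R n')
  end.

Section convex_bodies.
Context (R : realType) (n : nat).
Implicit Types (K : set 'rV[R]_n) (x u v : 'rV[R]_n).

Definition vol K : \bar R :=
  lebesgue_tuple R n [set t | K (\row_i tnth t i)].

Definition dot u v : R := \sum_(i < n) u 0 i * v 0 i.

(* The norm of the library on ['rV[R]_n] is the sup norm. *)
Definition unit_ball : set 'rV[R]_n := [set u | dot u u <= 1].

Definition unit_sphere : set 'rV[R]_n := [set u | dot u u = 1].

Definition convex_body K : Prop :=
  [/\ compact K, convex_set (K : set (convex_lmodType 'rV[R]_n)) & K° !=set0].

Definition parallel_body K (t : R) : set 'rV[R]_n :=
  [set v + t *: u | v in K & u in unit_ball].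

(* Two polynomials that agree on [0, +oo) are equal, so this determines [S]. *)
Definition steiner_polynomial K (S : {poly R}) : Prop :=
  forall t : R, 0 <= t -> vol (parallel_body K t) = S.[t]%:E.

Definition support_function K x : R := sup [set dot x v | v in K].

Definition partial (i : 'I_n) (f : 'rV[R]_n -> R) x : R :=
  'D_(delta_mx 0 i) f x.

Definition C1_on (U : set 'rV[R]_n) (f : 'rV[R]_n -> R) : Prop :=
  forall (i : 'I_n) x, U x ->
    derivable f x (delta_mx 0 i) /\ {for x, continuous (partial i f)}.

Definition C2_on (U : set 'rV[R]_n) (f : 'rV[R]_n -> R) : Prop :=
  C1_on U f /\ forall i : 'I_n, C1_on U (partial i f).

Definition C2_convex_body K : Prop :=
  convex_body K /\ C2_on [set x | x != 0] (support_function K).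

Definition hessian (f : 'rV[R]_n -> R) x : 'M[R]_n :=
  \matrix_(i, j) partial j (partial i f) x.

(* The Hessian of the 1-homogeneous support function at [w] kills [w] and is
   symmetric, hence maps the orthogonal of [w] to itself: the eigenvalues of its
   restriction are those with an eigenvector orthogonal to [w]. *)
Definition principal_radius K (w : 'rV[R]_n) (rho : R) : Prop :=
  exists v, [/\ v != 0, dot v w = 0 &
    v *m hessian (support_function K) w = rho *: v].

Definition principal_radii K : set R :=
  [set rho | exists2 w, unit_sphere w & principal_radius K w rho].

End convex_bodies.

Definition minimum (R : realType) (A : set R) (m : R) := A m /\ lbound A m.
Definition maximum (R : realType) (A : set R) (m : R) := A m /\ ubound A m.

Definition complex_poly (R : realType) (S : {poly R}) : {poly R[i]} :=
  map_poly (real_complex R) S.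

Definition stable (R : realType) (S : {poly R}) : Prop :=
  forall z : R[i], root (complex_poly S) z -> complex.Re z < 0.

Definition complex_roots (R : realType) (S : {poly R}) (zs : seq R[i]) : Prop :=
  complex_poly S =
  lead_coef (complex_poly S) *: \prod_(z <- zs) ('X - z%:P).

(* Main.v *)
Require Import Defs.
From HB Require Import structures.
From mathcomp Require Import all_boot all_order all_algebra.
From mathcomp Require Import all_classical all_reals all_analysis.
From mathcomp Require Import complex zify ring lra.
Set Implicit Arguments.
Unset Strict Implicit.
Unset Printing Implicit Defensive.
Import Order.TTheory GRing.Theory Num.Theory.
Import numFieldNormedType.Exports.
Local Open Scope classical_set_scope.
Local Open Scope ring_scope.

(** Write p for the support function of K, B for the unit ball, and let
0 <= s < rho_min and rho_max < t (if rho_min = 0, the upper bound is stability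
of S_K itself). The bounds on the principal radii say that
p - s |.| and t |.| - p have, on every tangent space of the sphere, a
positive definite Hessian; hence they are support functions of convex bodies
L and M, with K = L + sB and K + M = tB. Comparing volumes,
S_K(u) = S_L(s + u), and, volumes of Minkowski combinations being polynomial
in the weights, S_M(u) = (-1)^n S_K(- (t + u)) ([inner_steiner],
[outer_steiner]). So stability of S_L puts the roots of S_K to the left of - s
and stability of S_M puts them to the right of - t; now let s tend to rho_min
and t to rho_max.

The identity for S_M needs a formal substitution of negative weights, that is,
the existence of mixed volumes: vol(aK + bL) is a form of degree n in
a, b >= 0 ([mixed_volumes]). The proof given here is Khovanskii's. For finite
sets A, C of integer points, the number of points of the sumset kA + lC is
polynomial in k, l once both are large: choose for each point its least
representation by exponent vectors; the chosen vectors are closed under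
passing to smaller ones, so by Dickson's lemma they form a finite union of
translated orthants ([tame_count], [tame_sumset]). When A and C are the integer
points of mK and mL, the set kA + lC contains almost all integer points of
m(kK + lL) ([sumset_sub], [sub_sumset]), and counting points measures volume
([lattice_bounds]). The leading form of the polynomial therefore approximates
m^n vol(kK + lL) ([form_bounds]), and vol(kK + lL) is a limit of forms of
degree n.

That p - s |.| is a support function is proved on great circles: if
h is its restriction to such a circle, parametrized by arc length, then
h'' + h is the value of the quadratic form of the Hessian on the unit tangent
vector, shifted by - s, hence nonnegative, and a Sturm-type comparison shows
that the gradient at any unit vector x defines a linear function that lies
below p - s |.| and touches it at x ([circle_ineq], [wulff_grad]). The passage
from eigenvalues of the Hessian to its quadratic form is the minimum principle
for Rayleigh quotients ([rayleigh_min]), which needs the symmetry of second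
derivatives ([schwarz]). *)

(** * Dickson's lemma and Hilbert functions *)

Section exponent_vectors.
Local Open Scope nat_scope.

(** Take, again and again, an index past the previous one at which f is minimal
on the remaining tail. *)
Lemma nondecreasing_subseq (f : nat -> nat) :
  exists2 phi : nat -> nat, {homo phi : i j / i < j} &
    {homo f \o phi : i j / i <= j}.
Proof.
have minP N : exists i, N <= i /\ forall j, N <= j -> f i <= f j.
  have ex : exists v, `[< exists2 i, N <= i & f i = v >].
    by exists (f N); apply/asboolP; exists N.
  case: (ex_minnP ex) => v /asboolP[k Nk <-] vmin.
  by exists k; split=> // j Nj; apply: vmin; apply/asboolP; exists j.
have [m mP] := choice minP.
pose phi := fix phi k := if k is k'.+1 then m (phi k').+1 else m 0.
have phiS k : phi k < phi k.+1 by have [] := mP (phi k).+1.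
exists phi; first by exact: homo_ltn ltn_trans phiS.
apply: homo_leq => //; first exact: leq_trans.
move=> k; suff [N [Nk ek]] : exists N, N <= phi k /\ phi k = m N.
  have [_ minN] := mP N; have -> : (f \o phi) k = f (m N) by rewrite -ek.
  exact/minN/(leq_trans Nk)/ltnW/phiS.
by case: k => [|k]; [exists 0 | exists (phi k).+1; have [] := mP (phi k).+1].
Qed.

(** A nondecreasing subsequence is extracted coordinate by coordinate. *)
Lemma dickson d (f : nat -> seq nat) : (forall i, size (f i) = d) ->
  exists2 phi : nat -> nat, {homo phi : i j / i < j} &
    forall i j, i < j -> all2 leq (f (phi i)) (f (phi j)).
Proof.
elim: d f => [|d IHd] f fd.
  by exists id => // i j _; rewrite (size0nil (fd i)) (size0nil (fd j)).
have [phi phi_lt hd_le] := nondecreasing_subseq (fun i => head 0 (f i)).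
have [|psi psi_lt tl_le] := IHd (fun i => behead (f (phi i))).
  by move=> i; rewrite size_behead fd.
exists (phi \o psi) => [i j ij|i j ij]; first exact/phi_lt/psi_lt.
have := tl_le _ _ ij; have := hd_le _ _ (ltnW (psi_lt _ _ ij)) => /=.
by have := fd (phi (psi i)); have := fd (phi (psi j));
  case: (f _) => // a u _; case: (f _) => //= b v _ -> ->.
Qed.

Definition down_closed (W : pred (seq nat)) :=
  forall u v, all2 leq u v -> W v -> W u.

Lemma all2_leqnn v : all2 leq v v.
Proof. by elim: v => //= a v ->; rewrite leqnn. Qed.

Lemma down_closed_slice W j : down_closed W -> down_closed (fun v => W (j :: v)).
Proof. by move=> dW u v uv; apply: dW; rewrite /= leqnn. Qed.

(** The slices of W decrease with j. Vectors that witness infinitely many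
strict decreases would contain, by [dickson], a comparable pair, against
downward closure. *)
Lemma slices_stabilize d W : down_closed W ->
  exists J, forall j v, J <= j -> size v = d -> W (j :: v) = W (J :: v).
Proof.
move=> dW; apply: contrapT => nstab.
have stepP J : exists p : nat * seq nat,
    [/\ J <= p.1, size p.2 = d, W (J :: p.2) & ~~ W (p.1 :: p.2)].
  apply: contrapT => no; apply: nstab; exists J => j v Jj vd.
  apply/idP/idP => [|WJ]; first by apply: dW; rewrite /= Jj all2_leqnn.
  by apply: contrapT => /negP Wj; apply: no; exists (j, v).
have [F FP] := choice stepP.
(* J i+1 is a coordinate past J i at which the slice has lost the vector of J i *)
pose J i := iter i (fun k => (F k).1) 0.
have Jle : {homo J : i j / i <= j}.
  by apply: homo_leq => //; [exact: leq_trans | move=> i; have [] := FP (J i)].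
have [|phi phi_lt vle] := @dickson d (fun i => (F (J i)).2).
  by move=> i; have [] := FP (J i).
have /= le01 := vle 0 1 isT; have /= phi01 : phi 0 < phi 1 by exact: phi_lt.
have [_ _ W1 _] := FP (J (phi 1)); have [_ _ _ /negP] := FP (J (phi 0)); apply.
apply: dW W1; rewrite /= le01 andbT; exact: Jle phi01.
Qed.

(** Hilbert function of a translated orthant: the number of ways to write k - w
as an ordered sum of a naturals. *)
Fixpoint hilb a w k : nat :=
  if a is a'.+1 then \sum_(x < k.+1) hilb a' w x else k == w.

Arguments hilb : simpl never.

Lemma hilb0 w k : hilb 0 w k = (k == w). Proof. by []. Qed.

Lemma hilbS a w k : hilb a.+1 w k = \sum_(x < k.+1) hilb a w x.
Proof. by []. Qed.

Lemma hilbE a w k : hilb a.+1 w k = if w <= k then 'C(k - w + a, a) else 0.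
Proof.
elim: a k => [|a IHa] k.
  rewrite hilbS bin0; case: leqP => wk.
    rewrite (bigD1 (Ordinal (wk : w < k.+1)))//= hilb0 eqxx big1// => i.
    by rewrite -val_eqE /= hilb0 => /negbTE ->.
  rewrite big1// => i _; apply/eqP; rewrite hilb0 eqb0 neq_ltn.
  by rewrite (leq_trans (ltn_ord i)).
rewrite hilbS; elim: k => [|k IHk].
  rewrite big_ord_recl big_ord0 addn0 IHa; case: w {IHa} => [|w]//=.
  by rewrite !add0n !binn.
rewrite big_ord_recr/= IHk IHa; case: (ltngtP w k.+1) => wk.
- have wk' : w <= k by [].
  by rewrite wk' subSn// addSnnS [in RHS]addSn binS.
- by rewrite leqNgt (ltn_trans _ wk) .
- by rewrite wk ltnn subnn !add0n !binn.
Qed.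

Lemma hilb_shift a w j k :
  (if j <= k then hilb a w (k - j) else 0) = hilb a (w + j) k.
Proof.
case: a => [|a]; rewrite ?hilb0.
  case: leqP => jk; first by rewrite -(eqn_add2r j) subnK.
  by apply/esym/eqP; rewrite eqb0 neq_ltn (leq_trans jk)// leq_addl.
rewrite !hilbE; case: leqP => jk.
  by rewrite leq_subRL// -subnDA [w + j]addnC.
by rewrite leqNgt (leq_trans jk)// leq_addl.
Qed.

(** Sums of products of Hilbert functions of orthants, one factor per colour:
this class is closed under the operations by which [tame_count] eliminates one
coordinate, and its members are polynomial for large arguments ([tame_poly]).
*)
Definition tame (f : nat -> nat -> nat) :=
  exists s : seq ((nat * nat) * (nat * nat)),
    forall k l, f k l = \sum_(x <- s) hilb x.1.1 x.1.2 k * hilb x.2.1 x.2.2 l.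

Lemma eq_tame f g : (forall k l, f k l = g k l) -> tame f -> tame g.
Proof. by move=> fg [s fs]; exists s => k l; rewrite -fg. Qed.

Lemma tame_swap f : tame f -> tame (fun k l => f l k).
Proof.
move=> [s fs]; exists [seq (x.2, x.1) | x <- s] => k l.
by rewrite fs big_map; apply: eq_bigr => x _; rewrite mulnC.
Qed.

Lemma tame_add f g : tame f -> tame g -> tame (fun k l => f k l + g k l).
Proof. by move=> [s fs] [t gt]; exists (s ++ t) => k l; rewrite big_cat fs gt. Qed.

Lemma tame0 : tame (fun _ _ => 0).
Proof. by exists [::] => k l; rewrite big_nil. Qed.

Lemma tame_sum (F : nat -> nat -> nat -> nat) J : (forall j, tame (F j)) ->
  tame (fun k l => \sum_(j < J) F j k l).
Proof.
move=> tF; elim: J => [|J IHJ].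
  by apply: eq_tame tame0 => k l; rewrite big_ord0.
by apply: eq_tame (tame_add IHJ (tF J)) => k l; rewrite big_ord_recr.
Qed.

Lemma tame_shift f j : tame f ->
  tame (fun k l => if j <= k then f (k - j) l else 0).
Proof.
move=> [s fs]; exists [seq ((x.1.1, x.1.2 + j), x.2) | x <- s] => k l.
rewrite big_map fs.
transitivity (\sum_(x <- s)
    (if j <= k then hilb x.1.1 x.1.2 (k - j) else 0) * hilb x.2.1 x.2.2 l).
  by case: leqP => // _; rewrite big1.
by apply: eq_bigr => x _; rewrite hilb_shift.
Qed.

Lemma tame_psum f : tame f -> tame (fun k l => \sum_(x < k.+1) f x l).
Proof.
move=> [s fs]; exists [seq ((x.1.1.+1, x.1.2), x.2) | x <- s] => k l.
rewrite big_map; transitivity (\sum_(x < k.+1)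
    \sum_(i <- s) hilb i.1.1 i.1.2 x * hilb i.2.1 i.2.2 l).
  by apply: eq_bigr => x _; rewrite fs.
by rewrite exchange_big; apply: eq_bigr => x _; rewrite /= hilbS big_distrl.
Qed.

(** Split the sum at J: below it there are finitely many shifted terms, beyond
it a shifted partial sum of a single function. *)
Lemma tame_conv (F : nat -> nat -> nat -> nat) J : (forall j, tame (F j)) ->
  (forall j k l, J <= j -> F j k l = F J k l) ->
  tame (fun k l => \sum_(j < k.+1) F j (k - j) l).
Proof.
move=> tF stabF.
have t1 := tame_sum J (fun j => tame_shift j (tF j)).
apply: eq_tame (tame_add t1 (tame_shift J (tame_psum (tF J)))) => k l.
pose G j := F j (k - j) l.
have -> : \sum_(j < k.+1) F j (k - j) l = \sum_(0 <= j < k.+1) G j.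
  by rewrite big_mkord.
have -> : \sum_(j < J) (if j <= k then F j (k - j) l else 0) =
    \sum_(0 <= j < J | j <= k) G j by rewrite big_mkord -big_mkcond.
case: leqP => kJ.
  rewrite (@big_cat_nat _ _ _ J 0 k.+1)//= ?(leqW kJ)//; congr (_ + _).
    rewrite big_nat_cond [RHS]big_nat_cond; apply: eq_bigl => j.
    by case: ltnP => //= jJ; rewrite (leq_trans (ltnW jJ) kJ).
  rewrite -(big_mkord predT (fun x => F J x l)).
  have -> : \sum_(J <= j < k.+1) G j = \sum_(0 <= j < k.+1 - J) G (j + J).
    by rewrite -{1}[J]add0n big_addn.
  rewrite [RHS]big_nat_rev /= subSn// big_nat [RHS]big_nat.
  apply: eq_bigr => i /andP[_ ik]; rewrite /G stabF; last lia.
  congr (F J _ l); lia.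
rewrite addn0; rewrite (@big_cat_nat _ _ _ k.+1 0 J)//=.
rewrite [X in _ + X]big_nat_cond [X in _ + X]big1 ?addn0; last first.
  by move=> j /andP[/andP[kj _]]; rewrite leqNgt kj.
rewrite big_nat_cond [RHS]big_nat_cond; apply: eq_bigl => j.
by case: ltnP => //= jJ; rewrite jJ.
Qed.

(** Exponent vectors whose coordinates of colour false add up to k and those of
colour true to l. *)
Fixpoint expvecs (cs : seq bool) (k l : nat) : seq (seq nat) :=
  if cs is c :: cs' then
    if c then [seq j :: v | j <- iota 0 l.+1, v <- expvecs cs' k (l - j)]
    else [seq j :: v | j <- iota 0 k.+1, v <- expvecs cs' (k - j) l]
  else if (k == 0) && (l == 0) then [:: [::]] else [::].

Fixpoint cdeg (c : bool) (cs : seq bool) (v : seq nat) : nat :=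
  match cs, v with
  | c' :: cs', j :: v' => (if c' == c then j else 0) + cdeg c cs' v'
  | _, _ => 0
  end.

Lemma mem_expvecs cs k l v : (v \in expvecs cs k l) =
  [&& size v == size cs, cdeg false cs v == k & cdeg true cs v == l].
Proof.
elim: cs k l v => [|c cs IH] k l v.
  have -> : (size v == size [::]) = (v == [::]) by case: v.
  rewrite /=; case: ifP => [/andP[/eqP-> /eqP->]|kl].
    by rewrite mem_seq1 !eqxx !andbT.
  by rewrite in_nil ![0 == _]eq_sym kl andbF.
case: c.
  transitivity (v \in [seq j :: u | j <- iota 0 l.+1, u <- expvecs cs k (l - j)]).
    by [].
  apply/allpairsPdep/idP => [[j [u []]]|].
    rewrite IH mem_iota /= => jl /and3P[/eqP su /eqP dk /eqP dl] -> /=.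
    by rewrite su dk dl subnKC// !eqxx.
  case: v => // j u /and3P[su dk dl]; rewrite /= in su dk dl; exists j, u; split=> //.
    by rewrite mem_iota add0n ltnS -(eqP dl) leq_addr.
  by rewrite IH -eqSS su -(eqP dl) addKn eqxx -(eqP dk) add0n eqxx.
transitivity (v \in [seq j :: u | j <- iota 0 k.+1, u <- expvecs cs (k - j) l]).
  by [].
apply/allpairsPdep/idP => [[j [u []]]|].
  rewrite IH mem_iota /= => jl /and3P[/eqP su /eqP dk /eqP dl] -> /=.
  by rewrite su dk dl subnKC// !eqxx.
case: v => // j u /and3P[su dk dl]; rewrite /= in su dk dl; exists j, u; split=> //.
  by rewrite mem_iota add0n ltnS -(eqP dk) leq_addr.
by rewrite IH -eqSS su -(eqP dk) addKn eqxx -(eqP dl) add0n eqxx.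
Qed.

Lemma expvecs_uniq cs k l : uniq (expvecs cs k l).
Proof.
elim: cs k l => [|c cs IH] k l; first by rewrite /=; case: ifP.
by case: c; (apply: allpairs_uniq_dep; [exact: iota_uniq | by move=> j _ |
  by move=> [i u] [j v] _ _ /= [-> ->]]).
Qed.

(** Induction on the number of coordinates: sort the vectors by their first
coordinate j; the slices are downward closed and, by [slices_stabilize], only
finitely many of them are distinct. *)
Lemma tame_count cs W : down_closed W ->
  tame (fun k l => count W (expvecs cs k l)).
Proof.
elim: cs W => [|c cs IH] W dW.
  exists (if W [::] then [:: ((0, 0), (0, 0))] else [::]) => k l /=.
  by case: (W [::]) / idP => Wn; rewrite ?big_seq1 ?big_nil /= ?hilb0;
    case: k => [|k]; case: l => [|l] //=; rewrite ?Wn//; move/negP/negbTE : Wn => ->.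
have [J stabJ] := slices_stabilize (size cs) dW.
have countE j k l : J <= j -> count (fun v => W (j :: v)) (expvecs cs k l) =
    count (fun v => W (J :: v)) (expvecs cs k l).
  move=> Jj; apply: eq_in_count => v; rewrite mem_expvecs => /and3P[/eqP sv _ _].
  exact: stabJ.
have sum_pairs (m : nat) (s : nat -> seq (seq nat)) :
    count W [seq j :: v | j <- iota 0 m.+1, v <- s j] =
    \sum_(j < m.+1) count (fun v => W (val j :: v)) (s j).
  rewrite -(big_mkord predT (fun j => count (fun v => W (j :: v)) (s j))).
  rewrite /index_iota subn0; elim: (iota 0 m.+1) => [|j r IHr]/=.
    by rewrite big_nil.
  by rewrite big_cons count_cat IHr count_map.
case: c.
  apply: tame_swap.
  apply: (@eq_tame (fun k l => \sum_(j < k.+1)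
    count (fun v => W (val j :: v)) (expvecs cs l (k - j)))) => [k l|].
    by rewrite /= sum_pairs.
  apply: (@tame_conv
    (fun j k l => count (fun v => W (j :: v)) (expvecs cs l k)) J) => j.
    exact/tame_swap/IH/down_closed_slice.
  by move=> *; exact: countE.
apply: (@eq_tame (fun k l => \sum_(j < k.+1)
  count (fun v => W (val j :: v)) (expvecs cs (k - j) l))) => [k l|].
  by rewrite /= sum_pairs.
apply: (@tame_conv
  (fun j k l => count (fun v => W (j :: v)) (expvecs cs k l)) J) => j.
  exact/IH/down_closed_slice.
by move=> *; exact: countE.
Qed.

Fixpoint lexlt (u v : seq nat) : bool :=
  match u, v with
  | a :: u', b :: v' => (a < b) || ((a == b) && lexlt u' v')
  | _, _ => false
  end.

Definition vadd (u v : seq nat) := [seq p.1 + p.2 | p <- zip u v].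

Lemma lexlt_irr u : lexlt u u = false.
Proof. by elim: u => //= a u ->; rewrite ltnn andbF. Qed.

Lemma lexlt_trans : transitive lexlt.
Proof.
move=> v u w; elim: v u w => [|b v IH] [|a u] [|c w]//=.
move=> /orP[ab|/andP[/eqP-> uv]] /orP[bc|/andP[/eqP<- vw]].
- by rewrite (ltn_trans ab bc).
- by rewrite ab.
- by rewrite bc.
- by rewrite eqxx (IH _ _ uv vw) orbT.
Qed.

Lemma lexlt_total u v : size u = size v -> u != v -> lexlt u v || lexlt v u.
Proof.
elim: u v => [|a u IH] [|b v]//= [suv]; rewrite eqseq_cons.
by case: (ltngtP a b) => //= _; exact: IH.
Qed.

Lemma lexlt_vadd u v w : size u = size w -> size v = size w ->
  lexlt u v -> lexlt (vadd u w) (vadd v w).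
Proof.
elim: u v w => [|a u IH] [|b v] [|c w]//= [su] [sv].
by rewrite ltn_add2r eqn_add2r => /orP[->//|/andP[-> /IH->]//]; rewrite orbT.
Qed.

Lemma size_vadd u v : size u = size v -> size (vadd u v) = size v.
Proof. by move=> uv; rewrite size_map size2_zip ?uv. Qed.

Lemma all2_leq_vadd u v : all2 leq u v ->
  exists2 w, size u = size w & v = vadd u w.
Proof.
elim: u v => [|a u IH] [|b v]//=; first by exists [::].
move=> /andP[ab /IH[w uw ->]]; exists ((b - a) :: w); first by rewrite /= uw.
by rewrite /vadd /= subnKC.
Qed.

Lemma cdeg_vadd c cs u v : size u = size cs -> size v = size cs ->
  cdeg c cs (vadd u v) = cdeg c cs u + cdeg c cs v.
Proof.
elim: cs u v => [|c' cs IH] [|a u] [|b v]//= [su] [sv].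
by rewrite -/(vadd u v) IH//; case: (c' == c); lia.
Qed.

(** * Khovanskii's theorem on sumsets *)

Section sumsets.
Local Open Scope ring_scope.
Variable Z : zmodType.

Fixpoint evalvec (gs : seq (bool * Z)) (v : seq nat) : Z :=
  match gs, v with
  | g :: gs', j :: v' => g.2 *+ j + evalvec gs' v'
  | _, _ => 0
  end.

Lemma evalvec_vadd gs u v : size u = size gs -> size v = size gs ->
  evalvec gs (vadd u v) = evalvec gs u + evalvec gs v.
Proof.
elim: gs u v => [|g gs IH] [|a u] [|b v]//= => [_ _|[su] [sv]].
  by rewrite addr0.
by rewrite -/(vadd u v) IH// mulrnDr addrACA.
Qed.

Definition gens (A C : seq Z) := [seq (false, a) | a <- A] ++ [seq (true, c) | c <- C].

(** The set kA + lC of sums of k elements of A and l elements of C, without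
repetition. *)
Definition sumset (A C : seq Z) k l : seq Z :=
  undup [seq evalvec (gens A C) v | v <- expvecs (unzip1 (gens A C)) k l].

Variables A C : seq Z.
Let gs := gens A C.
Let cs := unzip1 gs.
Let E (v : seq nat) := expvecs cs (cdeg false cs v) (cdeg true cs v).

Let size_cs : size cs = size gs. Proof. by rewrite size_map. Qed.

Let memE v : size v = size cs -> v \in E v.
Proof. by move=> sv; rewrite mem_expvecs sv !eqxx. Qed.

Let beats u v := lexlt u v && (evalvec gs u == evalvec gs v).
(* the standard monomials of the sumset: those not beaten by a vector with the
   same degrees and the same value *)
Let useful v := (size v == size cs) && ~~ has (fun u => beats u v) (E v).

Let useful_down : down_closed useful.
Proof.
move=> u v uv /andP[/eqP sv nv].
have [w suw def_v] := all2_leq_vadd uv.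
have su : size u = size cs by rewrite suw -sv def_v size_vadd.
have sw : size w = size cs by rewrite -suw.
rewrite /useful su eqxx /=; apply: contra nv => /hasP[u' u'E /andP[u'u ev]].
move: u'E; rewrite mem_expvecs => /and3P[/eqP su' /eqP d0 /eqP d1].
apply/hasP; exists (vadd u' w); rewrite def_v.
  by rewrite mem_expvecs size_vadd ?su'// sw eqxx !cdeg_vadd// d0 d1 !eqxx.
rewrite /beats lexlt_vadd ?su'//= !evalvec_vadd ?(eqP ev)// -?size_cs//.
Qed.

Let beats_trans u v w : beats u v -> beats v w -> beats u w.
Proof.
move=> /andP[uv /eqP euv] /andP[vw /eqP evw].
by rewrite /beats (lexlt_trans uv vw) euv evw eqxx.
Qed.

Let mem_expvecs_E k l v : v \in expvecs cs k l ->
  [/\ size v = size cs, E v = expvecs cs k l & v \in E v].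
Proof.
rewrite mem_expvecs => /and3P[/eqP sv /eqP d0 /eqP d1].
by split; [|rewrite /E d0 d1|exact: memE].
Qed.

Let useful_repr k l v : v \in expvecs cs k l ->
  exists2 u, u \in expvecs cs k l & useful u /\ evalvec gs u = evalvec gs v.
Proof.
have [m le_m] := ubnP (size [seq u <- expvecs cs k l | beats u v]).
elim: m => // m IHm in v le_m *; rewrite ltnS in le_m => vkl.
have [sv Ev vE] := mem_expvecs_E vkl.
have [uv|] := boolP (useful v); first by exists v.
rewrite /useful sv eqxx /= negbK Ev => /hasP[u ukl uv].
have [||w wkl [uw ew]] := IHm u => //.
  apply: leq_trans le_m; have : uniq (u :: [seq w <- expvecs cs k l | beats w u]).
    rewrite /= mem_filter {1}/beats lexlt_irr/=.
    by rewrite filter_uniq ?expvecs_uniq.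
  move/uniq_leq_size; apply => w; rewrite inE !mem_filter.
  case/orP => [/eqP-> | /andP[wu ->]]; first by rewrite uv ukl.
  by rewrite (beats_trans wu uv).
by exists w => //; split=> //; rewrite ew; have /andP[_ /eqP] := uv.
Qed.

(** Every point of the sumset has exactly one useful representation, the
lexicographically least one. *)
Lemma size_sumset k l : size (sumset A C k l) = count useful (expvecs cs k l).
Proof.
rewrite -size_filter -(size_map (evalvec gs)); apply/perm_size/uniq_perm => [||x].
- exact: undup_uniq.
- rewrite map_inj_in_uniq ?filter_uniq ?expvecs_uniq// => u v.
  rewrite !mem_filter => /andP[uu ukl] /andP[uv vkl] euv.
  have [su Eu uE] := mem_expvecs_E ukl; have [sv Ev vE] := mem_expvecs_E vkl.
  apply: contrapT => /eqP/lexlt_total; rewrite su sv => /(_ erefl)/orP[] lt.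
    move: uv => /andP[_ /hasP]; apply; exists u; rewrite ?Ev//.
    by rewrite /beats lt euv eqxx.
  move: uu => /andP[_ /hasP]; apply; exists v; rewrite ?Eu//.
  by rewrite /beats lt euv eqxx.
rewrite mem_undup; apply/mapP/mapP => -[v].
  by move=> /useful_repr[u ukl [uu <-]] ->; exists u; rewrite ?mem_filter ?uu.
by rewrite mem_filter => /andP[_ vkl] ->; exists v.
Qed.

Lemma tame_sumset : tame (fun k l => size (sumset A C k l)).
Proof.
by apply: eq_tame (tame_count cs useful_down) => k l; rewrite size_sumset.
Qed.

Lemma sumset_uniq k l : uniq (sumset A C k l).
Proof. exact: undup_uniq. Qed.

Lemma sumset00 : 0 \in sumset A C 0 0.
Proof.
have [e [se e0]] : exists v, [/\ size v = size gs, forall c, cdeg c cs v = 0%N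
    & evalvec gs v = 0].
  rewrite /cs; elim: gs => [|g s [v [sv dv ev]]]; first by exists [::].
  by exists (0%N :: v); split=> /= [|c|]; rewrite ?sv ?dv ?ev ?mulr0n ?addr0 ?if_same.
by move=> ev; rewrite mem_undup -ev map_f// mem_expvecs se size_cs !e0 !eqxx.
Qed.

(** Together with [sumset00] and [sumset_ind], this characterizes the sumset by
adding one summand at a time, so that exponent vectors are not needed any more.
*)
Lemma sumsetD (c : bool) z k l x : (c, z) \in gs -> x \in sumset A C k l ->
  z + x \in sumset A C (if c then k else k.+1) (if c then l.+1 else l).
Proof.
move=> gz; rewrite !mem_undup => /mapP[v vkl ->].
have [e [se de <-]] : exists e, [/\ size e = size gs,
    forall c', cdeg c' cs e = (c == c') & evalvec gs e = z].
  rewrite /cs; elim: gs gz => //= g s IH; rewrite inE => /orP[/eqP <-|/IH].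
    exists (1%N :: nseq (size s) 0%N); split=> /=; first by rewrite size_nseq.
      move=> c'; rewrite (_ : cdeg _ _ _ = 0%N) ?addn0//.
      by elim: s {IH} => //= g' s ->; rewrite if_same.
    rewrite (_ : evalvec _ _ = 0) ?addr0//.
    by elim: s {IH} => //= g' s ->; rewrite mulr0n addr0.
  move=> [e [se de ee]]; exists (0%N :: e); split => /=; first by rewrite se.
    by move=> c'; rewrite if_same de.
  by rewrite mulr0n add0r.
move: vkl; rewrite mem_expvecs => /and3P[/eqP sv /eqP d0 /eqP d1].
rewrite -evalvec_vadd ?sv ?size_cs// map_f// mem_expvecs.
rewrite size_vadd ?sv ?se ?size_cs// eqxx !cdeg_vadd ?se ?sv ?size_cs//.
by rewrite d0 d1 !de; case: {gz de} c; rewrite !eqxx.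
Qed.

Lemma sumset_ind (P : nat -> nat -> Z -> Prop) : P 0%N 0%N 0 ->
  (forall (c : bool) z k l x, (c, z) \in gs -> P k l x ->
    P (if c then k else k.+1) (if c then l.+1 else l) (z + x)) ->
  forall k l x, x \in sumset A C k l -> P k l x.
Proof.
move=> P0 PD k l x; rewrite mem_undup => /mapP[v].
rewrite mem_expvecs => /and3P[/eqP sv /eqP <- /eqP <-] ->.
have gen s : {subset s <= gs} -> forall w, size w = size s ->
    P (cdeg false (unzip1 s) w) (cdeg true (unzip1 s) w) (evalvec s w); last first.
  by apply: gen; rewrite // sv size_cs.
elim: s {v sv} => [|g s IH] sgs [|j v]//= [sv].
have {IH}Pv := IH (fun y ys => sgs y (mem_behead (s := g :: s) ys)) _ sv.
elim: j => [|j]; first by rewrite mulr0n add0r !if_same.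
have gg : g \in gs by rewrite sgs ?mem_head.
case: g {sgs} gg => c z gg /=.
by rewrite mulrS -addrA => /(PD c z _ _ _ gg); case: (c).
Qed.

End sumsets.

Section eventual_polynomial.
Local Open Scope ring_scope.
Variable R : numFieldType.

Lemma hilb_poly a w : exists p : {poly R},
  forall k, (w < k)%N -> (hilb a w k)%:R = p.[k%:R].
Proof.
case: a => [|a].
  by exists 0 => k wk; rewrite hilb0 gtn_eqF// horner0.
exists (a`!%:R^-1 *: \prod_(i < a) ('X + (a%:R - w%:R - i%:R)%:P)) => k wk.
rewrite hilbE (ltnW wk) hornerZ horner_prod.
apply: (mulfI (x := a`!%:R)); first by rewrite pnatr_eq0 -lt0n fact_gt0.
rewrite mulVKf ?pnatr_eq0 -?lt0n ?fact_gt0//.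
rewrite -natrM mulnC bin_ffact ffact_prod natr_prod; apply: eq_bigr => i _.
rewrite hornerD hornerX hornerC natrB ?natrD ?natrB ?(ltnW wk)//; first by ring.
by rewrite (leq_trans (ltnW (ltn_ord i)))// leq_addl.
Qed.

Lemma tame_poly f : tame f -> exists (t : seq ({poly R} * {poly R})) N0,
  forall k l, (N0 <= k)%N -> (N0 <= l)%N ->
    (f k l)%:R = \sum_(p <- t) p.1.[k%:R] * p.2.[l%:R].
Proof.
move=> [s fs]; suff [t [N0 tP]] : exists (t : seq ({poly R} * {poly R})) N0,
  forall k l, (N0 <= k)%N -> (N0 <= l)%N ->
    (\sum_(x <- s) hilb x.1.1 x.1.2 k * hilb x.2.1 x.2.2 l)%:R =
    \sum_(p <- t) p.1.[k%:R] * p.2.[l%:R].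
  by exists t, N0 => k l N0k N0l; rewrite fs tP.
elim: s {f fs} => [|x s [t [N0 tP]]].
  by exists [::], 0%N => k l _ _; rewrite !big_nil.
have [p pP] := hilb_poly x.1.1 x.1.2; have [q qP] := hilb_poly x.2.1 x.2.2.
exists ((p, q) :: t), (maxn N0 (maxn x.1.2.+1 x.2.2.+1)) => k l.
rewrite !geq_max => /and3P[N0k wk _] /and3P[N0l _ wl].
by rewrite !big_cons natrD tP// natrM pP// qP.
Qed.

(** Coefficient of X^(n-i) Y^i in the homogeneous part of degree n of the sum
of the p.1(X) p.2(Y). *)
Definition form_coef (t : seq ({poly R} * {poly R})) n i : R :=
  \sum_(p <- t) p.1`_(n - i) * p.2`_i.

(** Restriction of the sum of the p.1(X) p.2(Y) to the ray through (k, l); its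
coefficient of degree n is the value at (k, l) of the homogeneous part of
degree n ([coef_ray_poly]). *)
Definition ray_poly (t : seq ({poly R} * {poly R})) (k l : R) : {poly R} :=
  \sum_(p <- t) (p.1 \Po (k *: 'X)) * (p.2 \Po (l *: 'X)).

Lemma horner_ray_poly t k l x :
  (ray_poly t k l).[x] = \sum_(p <- t) p.1.[k * x] * p.2.[l * x].
Proof.
rewrite /ray_poly horner_sum; apply: eq_bigr => p _.
by rewrite hornerM !horner_comp !hornerE.
Qed.

Lemma coef_comp_scaleX (p : {poly R}) k i : (p \Po (k *: 'X))`_i = p`_i * k ^+ i.
Proof.
elim/poly_ind: p i => [|p c IH] i; first by rewrite comp_poly0 !coef0 mul0r.
rewrite comp_polyD comp_polyM comp_polyX comp_polyC -scalerAr !coefD !coefC.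
rewrite coefZ !coefMX; case: i => [|i] /=; first by rewrite mulr0 expr0 mulr1.
by rewrite IH !addr0 exprS; ring.
Qed.

Lemma coef_ray_poly t k l n : (ray_poly t k l)`_n =
  \sum_(i < n.+1) form_coef t n i * k ^+ (n - i) * l ^+ i.
Proof.
rewrite /ray_poly coef_sum /form_coef.
under [RHS]eq_bigr do rewrite -mulrA mulr_suml.
rewrite exchange_big; apply: eq_bigr => p _; rewrite coefMr.
by apply: eq_bigr => i _; rewrite !coef_comp_scaleX; ring.
Qed.

End eventual_polynomial.

End exponent_vectors.

(** * Volumes of boxes and measurability of closed sets *)

Section boxes.
Context (R : realType).
Local Notation T := (measurableTypeR R).

Lemma tuple_box_measurable n (I : 'I_n -> set R) :
  (forall i, measurable (I i : set T)) ->
  measurable [set t : n.-tuple T | forall i, I i (tnth t i)].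
Proof.
move=> mI; rewrite (_ : mkset _ =
    \bigcap_(i in [set: 'I_n]) ((@tnth n T ^~ i) @^-1` I i)).
  apply: fin_bigcap_measurable => // i _.
  by rewrite -[X in measurable X]setTI; exact: (@measurable_tnth _ T n i).
by apply/seteqP; split=> [t It i _|t It i]; exact: It.
Qed.

Lemma lebesgue_tuple_box n (I : 'I_n -> set R) :
  (forall i, measurable (I i : set T)) ->
  lebesgue_tuple R n [set t | forall i, I i (tnth t i)] =
  (\prod_(i < n) lebesgue_measure (I i : set T))%E.
Proof.
elim: n I => [|n IHn] I mI.
  rewrite big_ord0 /= diracE mem_set//= => -[].
  by [].
rewrite big_ord_recl -(IHn (fun i => I (lift ord0 i)))//.
rewrite -product_measure1E//=; last first.
  exact: (@tuple_box_measurable n (fun i => I (lift ord0 i))).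
rewrite /lebesgue_cons /pushforward; congr (_ _).
apply/seteqP; split=> -[x t] /=.
  move=> It; split; first by have := It ord0; rewrite tnth0.
  by move=> i; have := It (lift ord0 i); rewrite tnthS.
move=> [/= Ix It] i; case: (unliftP ord0 i) => [j ->|->]; rewrite ?tnthS ?tnth0//.
Qed.

End boxes.

Section cells.
Context (R : realType) (n : nat).
Local Notation T := (measurableTypeR R).
Implicit Types (a x y : 'rV[R]_n) (h : R) (M : set 'rV[R]_n) (q : 'rV[int]_n).

(** Volumes are computed on tuples of reals. *)
Definition tuples M : set (n.-tuple T) := [set t | M (\row_i tnth t i)].

Definition cell a h : set 'rV[R]_n :=
  [set x | forall i, a 0 i <= x 0 i < a 0 i + h].

Lemma tuples_cell a h : tuples (cell a h) =
  [set t | forall i : 'I_n, `[a 0 i, a 0 i + h[%classic (tnth t i)].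
Proof.
apply/seteqP; split=> t /= at_ i; have := at_ i; rewrite ?mxE.
  by rewrite /= in_itv.
by rewrite /= in_itv.
Qed.

Lemma cell_measurable a h : measurable (tuples (cell a h)).
Proof.
rewrite tuples_cell.
apply: (@tuple_box_measurable R n (fun i => `[a 0 i, a 0 i + h[%classic)) => i.
exact: measurable_itv.
Qed.

Lemma vol_cell a h : 0 <= h -> vol (cell a h) = (h ^+ n)%:E.
Proof.
move=> h0; rewrite /vol -/(tuples _) tuples_cell.
rewrite (@lebesgue_tuple_box R n (fun i => `[a 0 i, a 0 i + h[%classic)); last first.
  by move=> i; exact: measurable_itv.
rewrite (eq_bigr (fun=> h%:E)) => [|i _].
  by rewrite prodEFin big_const_ord iter_mulr_1.
rewrite lebesgue_measure_itv/= lte_fin ltrDl.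
move: h0; rewrite le_eqVlt => /orP[/eqP<-|->]; first by rewrite ltxx.
by rewrite -EFinB addrAC subrr add0r.
Qed.

Definition lattice a h q : 'rV[R]_n := a + h *: map_mx intr q.

Lemma cell_inj a h q q' x : 0 < h ->
  cell (lattice a h q) h x -> cell (lattice a h q') h x -> q = q'.
Proof.
move=> h0 xq xq'; apply/rowP => i; move: (xq i) (xq' i); rewrite !mxE.
set u := q 0 i; set v := q' 0 i => /andP[u1 u2] /andP[v1 v2].
have uv : (u < v + 1)%R.
  rewrite -(ltr_int R) intrD -(ltr_pM2l h0) mulrDr mulr1; lra.
have vu : (v < u + 1)%R.
  rewrite -(ltr_int R) intrD -(ltr_pM2l h0) mulrDr mulr1; lra.
lia.
Qed.

Lemma cell_cover a h x : 0 < h -> exists q, cell (lattice a h q) h x.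
Proof.
move=> h0; exists (\row_i Num.floor ((x 0 i - a 0 i) / h)) => i; rewrite !mxE.
have := floor_itv ((x 0 i - a 0 i) / h); rewrite ler_pdivlMr// ltr_pdivrMr//.
by rewrite intrD [(_ + _) * h]mulrDl mul1r ![h * _]mulrC => /andP[]; lra.
Qed.

Lemma vol_le M M' : measurable (tuples M) -> measurable (tuples M') ->
  M `<=` M' -> (vol M <= vol M')%E.
Proof.
move=> mM mM' MM'; apply: le_measure; rewrite ?inE// => t; exact: MM'.
Qed.

Lemma cells_le_vol M a h (s : seq 'rV[int]_n) : measurable (tuples M) -> 0 < h ->
  uniq s -> (forall q, q \in s -> cell (lattice a h q) h `<=` M) ->
  (((size s)%:R * h ^+ n)%:E <= vol M)%E.
Proof.
move=> mM h0 us sM.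
have -> : ((size s)%:R * h ^+ n)%:E =
    lebesgue_tuple R n (\bigcup_(q in [set` s]) tuples (cell (lattice a h q) h)).
  rewrite measure_fin_bigcup//=; first last.
  - by move=> q _; exact: cell_measurable.
  - by move=> q q' _ _ [t [tq tq']]; exact: cell_inj h0 tq tq'.
  rewrite -fsbig_seq//= (eq_bigr (fun=> (h ^+ n)%:E)) => [|q _]; last first.
    by rewrite -/(vol _) vol_cell// ltW.
  rewrite sumEFin big_const_seq count_predT iter_addr_0.
  by rewrite mulr_natl.
apply: le_measure; rewrite ?inE//.
  by apply: fin_bigcup_measurable => // q _; exact: cell_measurable.
by move=> t [q /= qs]; exact: sM.
Qed.

Lemma vol_le_cells M a h (s : seq 'rV[int]_n) : measurable (tuples M) -> 0 < h ->
  uniq s -> (forall x, M x -> exists2 q, q \in s & cell (lattice a h q) h x) ->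
  (vol M <= ((size s)%:R * h ^+ n)%:E)%E.
Proof.
move=> mM h0 us sM.
have -> : ((size s)%:R * h ^+ n)%:E =
    (\sum_(q \in [set` s]) lebesgue_tuple R n (tuples (cell (lattice a h q) h)))%E.
  rewrite -fsbig_seq//= (eq_bigr (fun=> (h ^+ n)%:E)) => [|q _]; last first.
    by rewrite -/(vol _) vol_cell// ltW.
  by rewrite sumEFin big_const_seq count_predT iter_addr_0 mulr_natl.
apply: content_sub_fsum => //.
- exact: finite_seq.
- by move=> q _; exact: cell_measurable.
by move=> t /sM[q qs qt]; exists q.
Qed.

(** A closed set is the intersection over k of the countable unions of the
cells of side 1/(k+1) that meet it. *)
Lemma closed_measurable M : closed M -> measurable (tuples M).
Proof.
move=> cM.
pose U k := \bigcup_(q : 'rV[int]_n)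
  (if `[< cell (lattice 0 k.+1%:R^-1 q) k.+1%:R^-1 `&` M !=set0 >]
   then tuples (cell (lattice 0 k.+1%:R^-1 q) k.+1%:R^-1) else set0).
rewrite (_ : tuples M = \bigcap_k U k).
  apply: bigcapT_measurable => k; apply: countable_bigcupT_measurable => //.
  by move=> q; case: asboolP => // _; exact: cell_measurable.
have k0 k : 0 < k.+1%:R^-1 :> R by rewrite invr_gt0.
apply/seteqP; split=> [t Mt k _|t Ut].
  have [q qt] := cell_cover 0 (\row_i tnth t i) (k0 k).
  by exists q => //; case: asboolP => // -[]; exists (\row_i tnth t i).
rewrite /tuples /=; set x := \row_i _; rewrite ((closure_id M).1 cM).
move=> B /nbhs_ballP[e /= e0 eB].
have [k ke] : exists k, k.+1%:R^-1 < e.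
  by have [k] := ltr_add_invr e0; rewrite add0r => ?; exists k.
have [q _] := Ut k I; case: asboolP => // -[y [yq My]] tq.
exists y; split=> //; apply: eB; split=> // i j; rewrite ord1.
have := tq j; have := yq j; rewrite /x !mxE => h1 h2.
(* two points of one cell of side d differ by less than d *)
have aux (d z u v : R) : 0 + z <= u < 0 + z + d -> 0 + z <= v < 0 + z + d ->
    d < e -> `|v - u| < e.
  by move=> /andP[? ?] /andP[? ?] ?; rewrite ltr_norml; apply/andP; split; lra.
by rewrite -ball_normE /=; exact: aux h1 h2 ke.
Qed.

End cells.

(** * Lattice points in convex sets *)

Section lattice_counts.
Context (R : realType) (n : nat).
Implicit Types (a x y : 'rV[R]_n) (h r : R) (M : set 'rV[R]_n) (q : 'rV[int]_n).

Lemma convex_setP M : convex_set (M : set (convex_lmodType 'rV[R]_n)) <->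
  (forall x y (t : R), M x -> M y -> 0 <= t -> t <= 1 -> M (t *: x + (1 - t) *: y)).
Proof.
split=> [cM x y t Mx My t0 t1|cM x y l].
  have := cM x y (Itv01 t0 t1); rewrite !inE => /(_ Mx My).
  by [].
by rewrite !inE => Mx My; apply: cM.
Qed.

Definition box_around (x0 : 'rV[R]_n) r : set 'rV[R]_n :=
  [set x | forall i, `|x 0 i - x0 0 i| <= r].

Definition bounded_by M (c : R) := forall x, M x -> forall i, `|x 0 i| <= c.

Lemma vol_fin_num M c : measurable (tuples M) -> bounded_by M c ->
  vol M \is a fin_num.
Proof.
move=> mM Mc; rewrite ge0_fin_numE ?measure_ge0//.
pose c' := Num.max c 0.
have c'0 : 0 <= c' by rewrite le_max lexx orbT.
apply: (@le_lt_trans _ _ (vol (cell (\row_i (- c')) (c' + c' + 1)))).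
  apply: vol_le => //; first exact: cell_measurable.
  move=> x /Mc xc i; rewrite !mxE; have := xc i; rewrite ler_norml => /andP[].
  by have : c <= c' by [rewrite le_max lexx]; lra.
by rewrite vol_cell ?ltry// !addr_ge0.
Qed.

Lemma latticeE a h q i : lattice a h q 0 i = a 0 i + h * (q 0 i)%:~R.
Proof. by rewrite !mxE. Qed.

(** Shrink the lattice towards x0 by the factor th = 1 / (1 + h/r). The cell at
the image of a lattice point q of M is th q plus (1 - th) times a point of the
box around x0, because th h = (1 - th) r; so it lies in M by convexity. *)
Lemma lattice_le_vol M a h x0 r (s : seq 'rV[int]_n) :
  measurable (tuples M) -> convex_set (M : set (convex_lmodType 'rV[R]_n)) ->
  0 < r -> box_around x0 r `<=` M -> 0 < h -> uniq s ->
  (forall q, q \in s -> M (lattice a h q)) ->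
  (((size s)%:R * (h / (1 + h / r)) ^+ n)%:E <= vol M)%E.
Proof.
move=> mM /convex_setP cM r0 x0M h0 us sM.
have hr0 : 0 < r + h by lra.
pose th := r / (r + h).
have th01 : 0 < th < 1 by rewrite divr_gt0//= ltr_pdivrMr// mul1r; lra.
have hE : h / (1 + h / r) = th * h by rewrite /th; field; lra.
rewrite hE; apply: (@cells_le_vol _ _ _ (th *: a + (1 - th) *: x0)) => //.
  by rewrite mulr_gt0//; lra.
move=> q qs x xq.
(* the point of the box for which x = th q + (1 - th) y *)
pose y := (1 - th)^-1 *: (x - th *: lattice a h q).
have -> : x = th *: lattice a h q + (1 - th) *: y.
  rewrite /y scalerA divff ?scale1r; last by rewrite gt_eqF//; lra.
  by rewrite addrC subrK.
apply: cM; [exact: sM| |lra|lra]; apply: x0M => i.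
have := xq i; rewrite /y !latticeE !mxE => /andP[x1 x2].
have rE : r * (1 - th) = th * h by rewrite /th; field; lra.
have t1 : 0 < 1 - th by lra.
rewrite ler_norml lerBrDr lerBlDr.
rewrite -[_^-1 * _]mulrC ler_pdivrMr// ler_pdivlMr//.
by apply/andP; split; nra.
Qed.

(** The counterpart of [lattice_le_vol]: with th = 1 / (1 - h/r), the enlarged
cells that meet M come from lattice points that lie in M, by convexity again.
*)
Lemma vol_le_lattice M a h x0 r (s : seq 'rV[int]_n) :
  measurable (tuples M) -> convex_set (M : set (convex_lmodType 'rV[R]_n)) ->
  0 < r -> box_around x0 r `<=` M -> 0 < h -> h < r -> uniq s ->
  (forall q, M (lattice a h q) -> q \in s) ->
  (vol M <= ((size s)%:R * (h / (1 - h / r)) ^+ n)%:E)%E.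
Proof.
move=> mM /convex_setP cM r0 x0M h0 hr us sM.
have hr0 : 0 < r - h by lra.
pose th := r / (r - h).
have th0 : 0 < th by rewrite divr_gt0.
have hE : h / (1 - h / r) = th * h by rewrite /th; field; lra.
have thh : 0 < th * h by rewrite mulr_gt0.
rewrite hE; apply: (@vol_le_cells _ _ _ (th *: a + (1 - th) *: x0)) => // x Mx.
have [q xq] := cell_cover (th *: a + (1 - th) *: x0) x thh.
exists q => //; apply: sM.
have th1 : th^-1 = 1 - h / r by rewrite /th; field; lra.
(* the point of the box for which q = (1 - h/r) x + (h/r) y *)
pose y := (r / h) *: (lattice a h q - (1 - h / r) *: x).
have -> : lattice a h q = (1 - h / r) *: x + (1 - (1 - h / r)) *: y.
  by apply/rowP => i; rewrite /y !mxE; field; lra.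
have hr1 : 0 < h / r < 1 by rewrite divr_gt0//= ltr_pdivrMr// mul1r.
apply: cM => //; [|lra|lra]; apply: x0M => i.
have := xq i; rewrite /y !latticeE !mxE => /andP[x1 x2].
rewrite -th1; have thn : th != 0 by rewrite gt_eqF.
set L := a 0 i + h * _.
have E : th * h * (r / h * (L - th^-1 * x 0 i) - x0 0 i) =
   r * (th * L - x 0 i - (th - 1) * x0 0 i) + (r * th - r - th * h) * x0 0 i.
  by field; lra.
have E2 : r * th - r - th * h = 0 by rewrite /th; field; lra.
rewrite E2 mul0r addr0 in E.
rewrite -(ler_pM2l thh) -{1}(gtr0_norm thh) -normrM E normrM (gtr0_norm r0).
rewrite [leRHS]mulrC ler_pM2l// ler_norml /L.
by apply/andP; split; nra.
Qed.

Lemma lattice_enum M c a h : bounded_by M c -> 0 < h ->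
  exists2 s : seq 'rV[int]_n, uniq s & forall q, q \in s <-> M (lattice a h q).
Proof.
move=> Mc h0.
have [k kP] : exists k : nat, forall i : 'I_n, (c + `|a 0 i|) / h < k%:R.
  pose d := (c + \sum_(i < n) `|a 0 i|) / h.
  exists (Num.bound `|d|) => i; apply: (@le_lt_trans _ _ d).
    rewrite ler_pM2r ?invr_gt0// lerD2l (bigD1 i)//= lerDl.
    by apply: sumr_ge0.
  by apply: le_lt_trans (ler_norm _) (archi_boundP _); rewrite normr_ge0.
pose F (f : {ffun 'I_n -> 'I_(k + k).+1}) : 'rV[int]_n :=
  \row_i ((f i : nat)%:Z - k%:Z)%R.
exists [seq q <- undup [seq F f | f : {ffun 'I_n -> 'I_(k + k).+1}] |
        `[< M (lattice a h q) >]]; first by rewrite filter_uniq// undup_uniq.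
move=> q; rewrite mem_filter; split=> [/andP[/asboolP//]|Mq].
rewrite asboolT//= mem_undup; apply/mapP.
have qk i : `|q 0 i| < k%:Z.
  rewrite -(ltr_int R) intr_norm; apply: le_lt_trans (kP i).
  have : `|h * (q 0 i)%:~R| <= c + `|a 0 i|.
    rewrite (_ : h * _ = lattice a h q 0 i - a 0 i); last first.
      by rewrite latticeE; ring.
    by rewrite (le_trans (ler_normB _ _))// lerD2r; exact: Mc.
  by rewrite normrM (gtr0_norm h0) ler_pdivlMr// mulrC.
exists [ffun i => inord (absz (q 0 i + k%:Z)%R)]; first by rewrite mem_enum.
apply/rowP => i; rewrite !mxE ffunE.
by have := qk i; move: (q 0 i) => z zk; rewrite inordK; lia.
Qed.

End lattice_counts.

(** Used to let a relative error e tend to 0 in inequalities that are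
polynomial in e. *)
Lemma horner_ge0_right (R : realType) (p : {poly R}) (d : R) : 0 < d ->
  (forall e, 0 < e -> e < d -> 0 <= p.[e]) -> 0 <= p.[0].
Proof.
move=> d0 pP; have pc : p.[x] @[x --> 0^'+] --> p.[0].
  by apply: cvg_at_right_filter; exact: continuous_horner.
apply: (cvgr_to_ge pc); near=> e; apply: pP; near: e.
  exact: nbhs_right_gt.
exact: nbhs_right_lt.
Unshelve. all: by end_near. Qed.

(** * Minkowski combinations of convex bodies *)

Section minkowski.
Context (R : realType) (n : nat).
Implicit Types (K L M : set 'rV[R]_n) (x y : 'rV[R]_n) (a b r : R).

Definition mink a K b L : set 'rV[R]_n :=
  [set a *: x + b *: y | x in K & y in L].

Definition dilate (l : R) y M : set 'rV[R]_n := [set l *: x + y | x in M].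

Definition volR M : R := fine (vol M).

Lemma compact_bounded_by M : compact M -> exists c, bounded_by M c.
Proof.
move=> /compact_bounded[c [_ cP]]; exists (c + 1) => x Mx i.
have : `|x| <= c + 1 by apply: cP => //; rewrite ltrDl.
apply: le_trans; have -> : `|x| = mx_norm x by [].
rewrite mx_normrE.
by apply/bigmax_geP; right; exists (0, i).
Qed.

Lemma compact_rV_closed M : compact M -> closed M.
Proof. by move=> cM; apply: compact_closed => //; exact: norm_hausdorff. Qed.

Lemma convex_body_compact M : convex_body M -> compact M.
Proof. by case. Qed.

Lemma convex_body_conv M : convex_body M ->
  forall x y (t : R), M x -> M y -> 0 <= t -> t <= 1 -> M (t *: x + (1 - t) *: y).
Proof. by case=> _ /convex_setP. Qed.

Lemma convex_body_measurable M : convex_body M -> measurable (tuples M).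
Proof. by case=> cM _ _; apply: closed_measurable; exact: compact_rV_closed. Qed.

Lemma convex_body_box M : convex_body M ->
  exists x0 r, 0 < r /\ box_around x0 r `<=` M.
Proof.
case=> _ _ [x0]; rewrite /interior => /nbhs_ballP[e /= e0 eM].
exists x0, (e / 2); split; first by rewrite divr_gt0.
move=> x xe; apply: eM; split=> // i j; rewrite ord1 -ball_normE /=.
by rewrite distrC (le_lt_trans (xe j))//; lra.
Qed.

Lemma box_nbhs x0 r : 0 < r -> nbhs x0 (box_around x0 r).
Proof.
move=> r0; apply/nbhs_ballP; exists r => //= x [_ xr] i.
by have := xr 0 i; rewrite -ball_normE /= distrC => /ltW.
Qed.

Lemma convex_bodyI M x0 r : compact M ->
  (forall x y (t : R), M x -> M y -> 0 <= t -> t <= 1 -> M (t *: x + (1 - t) *: y)) ->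
  0 < r -> box_around x0 r `<=` M -> convex_body M.
Proof.
move=> cM /convex_setP vM r0 rM; split=> //; exists x0.
by apply: filterS rM _; exact: box_nbhs.
Qed.

Lemma volR_E M : convex_body M -> vol M = (volR M)%:E.
Proof.
move=> bM; rewrite /volR fineK//.
have [c cP] := compact_bounded_by (convex_body_compact bM).
exact: vol_fin_num (convex_body_measurable bM) cP.
Qed.

Lemma volR_ge0 M : 0 <= volR M.
Proof. by apply: fine_ge0; exact: measure_ge0. Qed.

Lemma volR_le M M' : convex_body M -> convex_body M' -> M `<=` M' ->
  volR M <= volR M'.
Proof.
move=> bM bM' MM'; rewrite -lee_fin -!volR_E//.
by apply: vol_le => //; exact: convex_body_measurable.
Qed.

(** Counts of lattice points determine the volume of a convex body with a
relative error that tends to 0 with h, whatever the origin a of the lattice. *)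
Lemma lattice_bounds M (a : 'rV[R]_n) h x0 r (s : seq 'rV[int]_n) : convex_body M ->
  0 < r -> box_around x0 r `<=` M -> 0 < h -> h < r -> uniq s ->
  (forall q, q \in s <-> M (lattice a h q)) ->
  (size s)%:R * h ^+ n <= (1 + h / r) ^+ n * volR M /\
  (1 - h / r) ^+ n * volR M <= (size s)%:R * h ^+ n.
Proof.
move=> bM r0 rM h0 hr us sM; have mM := convex_body_measurable bM.
have vM : convex_set (M : set (convex_lmodType 'rV[R]_n)) by case: bM.
have hr1 : 0 < h / r < 1 by rewrite divr_gt0//= ltr_pdivrMr// mul1r.
have := @lattice_le_vol _ _ M a h x0 r s mM vM r0 rM h0 us (fun q => (sM q).1).
have := @vol_le_lattice _ _ M a h x0 r s mM vM r0 rM h0 hr us (fun q => (sM q).2).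
rewrite volR_E// !lee_fin !expr_div_n !mulrA => lo hi; split.
  by rewrite [leRHS]mulrC -ler_pdivrMr//; apply: exprn_gt0; lra.
by rewrite mulrC -ler_pdivlMr//; apply: exprn_gt0; lra.
Qed.

Lemma dilate_compact l y M : compact M -> compact (dilate l y M).
Proof.
move=> cM; apply: continuous_compact => //; apply: continuous_subspaceT => x.
by apply: continuousD; [exact: scaler_continuous | exact: cst_continuous].
Qed.

Lemma dilate_box l y M x0 r : 0 < l -> box_around x0 r `<=` M ->
  box_around (l *: x0 + y) (l * r) `<=` dilate l y M.
Proof.
move=> l0 rM x xr; exists (l^-1 *: (x - y)); last first.
  by rewrite scalerA divff ?gt_eqF// scale1r subrK.
apply: rM => i; have := xr i; rewrite !mxE.
rewrite (_ : _ * _ - _ = l^-1 * (x 0 i - (l * x0 0 i + y 0 i))); last first.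
  by field; rewrite gt_eqF.
rewrite normrM (@gtr0_norm _ l^-1) ?invr_gt0// => xl.
by rewrite mulrC ler_pdivrMr// [r * l]mulrC.
Qed.

Lemma dilate_convex_body l y M : 0 < l -> convex_body M ->
  convex_body (dilate l y M).
Proof.
move=> l0 bM; have [x0 [r [r0 rM]]] := convex_body_box bM.
have cD := dilate_compact (l := l) (y := y) (convex_body_compact bM).
have lr0 : 0 < l * r by rewrite mulr_gt0.
apply: (convex_bodyI cD _ lr0 (@dilate_box l y M x0 r l0 rM)).
move=> _ _ t [u Mu <-] [v Mv <-] t0 t1.
exists (t *: u + (1 - t) *: v); first exact: (convex_body_conv bM).
by apply/rowP => i; rewrite !mxE; ring.
Qed.

(** Scaling and translation map the points of a lattice in M to those of
another lattice in the image; both volumes are thus limits of the same counts.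
*)
Lemma volR_dilate l y M : 0 < l -> convex_body M ->
  volR (dilate l y M) = l ^+ n * volR M.
Proof.
move=> l0 bM; have [x0 [r [r0 rM]]] := convex_body_box bM.
have [c cP] := compact_bounded_by (convex_body_compact bM).
have bD := dilate_convex_body y l0 bM; have rD := @dilate_box l y M x0 r l0 rM.
have limit (A B : R) : (forall e : R, 0 < e -> e < 1 -> (1 - e) ^+ n * A <= (1 + e) ^+ n * B) ->
    A <= B.
  move=> AB; rewrite -subr_ge0.
  pose p : {poly R} := (1%:P + 'X) ^+ n * B%:P - (1%:P - 'X) ^+ n * A%:P.
  have pE e : p.[e] = (1 + e) ^+ n * B - (1 - e) ^+ n * A.
    by rewrite /p hornerD hornerN !hornerM !horner_exp !hornerD hornerN !hornerX !hornerC.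
  have := @horner_ge0_right R p 1 ltr01.
  rewrite pE !addr0 subr0 !expr1n !mul1r; apply => e e0 e1.
  by rewrite pE subr_ge0; exact: AB.
have main (e : R) : 0 < e -> e < 1 -> exists2 N : R,
    N <= (1 + e) ^+ n * volR M /\ (1 - e) ^+ n * volR M <= N &
    l ^+ n * N <= (1 + e) ^+ n * volR (dilate l y M) /\
    (1 - e) ^+ n * volR (dilate l y M) <= l ^+ n * N.
  move=> e0 e1; have h0 : 0 < e * r by rewrite mulr_gt0.
  have [s us sP] := lattice_enum 0 cP h0.
  exists ((size s)%:R * (e * r) ^+ n).
    have := lattice_bounds bM r0 rM h0 _ us sP.
    by rewrite mulfK ?gt_eqF//; apply; nra.
  have eE : (l * (e * r)) / (l * r) = e by field; rewrite !gt_eqF.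
  rewrite mulrCA -exprMn.
  have := lattice_bounds bD _ rD _ _ us (a := y) (h := l * (e * r)).
  rewrite eE; apply => [||| q].
  - by rewrite mulr_gt0.
  - by rewrite mulr_gt0.
  - by rewrite ltr_pM2l//; nra.
  rewrite sP; have latE : lattice y (l * (e * r)) q = l *: lattice 0 (e * r) q + y.
    by apply/rowP => i; rewrite !mxE; ring.
  rewrite latE; split=> [Mq|[x Mx /addIr/scalerI]]; first by exists (lattice 0 (e * r) q).
  by move=> <-//; rewrite gt_eqF.
have ln0 : 0 < l ^+ n by rewrite exprn_gt0.
apply/eqP; rewrite eq_le; apply/andP; split; apply: limit => e e0 e1.
  have [N [h _] [_ h2]] := main e e0 e1.
  by rewrite (le_trans h2)// [leRHS]mulrCA ler_pM2l.
have [N [_ h] [h1 _]] := main e e0 e1.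
by rewrite (le_trans _ h1)// mulrCA ler_pM2l.
Qed.

Lemma mink_compact a K b L : compact K -> compact L -> compact (mink a K b L).
Proof.
move=> cK cL; rewrite (_ : mink a K b L =
    (fun p : 'rV[R]_n * 'rV[R]_n => a *: p.1 + b *: p.2) @` (K `*` L)).
  apply: continuous_compact; last exact: compact_setX.
  apply: continuous_subspaceT => p.
  apply: cvgD.
    by apply: cvgZ; [exact: cvg_cst | exact: cvg_fst].
  by apply: cvgZ; [exact: cvg_cst | exact: cvg_snd].
apply/seteqP; split=> [_ [x Kx [y Ly <-]]|_ [[x y] [Kx Ly] <-]].
  by exists (x, y).
by exists x => //; exists y.
Qed.

Lemma mink_conv a K b L : convex_body K -> convex_body L ->
  forall x y (t : R), mink a K b L x -> mink a K b L y -> 0 <= t -> t <= 1 ->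
  mink a K b L (t *: x + (1 - t) *: y).
Proof.
move=> bK bL _ _ t [x Kx [y Ly <-]] [x' Kx' [y' Ly' <-]] t0 t1.
exists (t *: x + (1 - t) *: x'); first exact: (convex_body_conv bK).
exists (t *: y + (1 - t) *: y'); first exact: (convex_body_conv bL).
by apply/rowP => i; rewrite !mxE; ring.
Qed.

Lemma mink_box a K b L x0 y0 r r' : 0 <= a -> 0 <= b -> 0 < a * r + b * r' ->
  0 < r -> 0 < r' ->
  box_around x0 r `<=` K -> box_around y0 r' `<=` L ->
  box_around (a *: x0 + b *: y0) (a * r + b * r') `<=` mink a K b L.
Proof.
move=> a0 b0 s0 r0 r'0 rK rL z zr; set s := a * r + b * r' in s0 zr *.
pose w := s^-1 *: (z - (a *: x0 + b *: y0)).
have w1 i : `|w 0 i| <= 1.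
  by rewrite !mxE normrM gtr0_norm ?invr_gt0// mulrC ler_pdivrMr// mul1r;
    have := zr i; rewrite !mxE.
exists (x0 + r *: w).
  by apply: rK => i; rewrite mxE mxE [_ + _ - _]addrAC subrr add0r normrM gtr0_norm// ler_piMr// ltW.
exists (y0 + r' *: w).
  by apply: rL => i; rewrite mxE mxE [_ + _ - _]addrAC subrr add0r normrM gtr0_norm// ler_piMr// ltW.
apply/rowP => i; rewrite !mxE.
set D := (X in s^-1 * X).
transitivity (a * x0 0 i + b * y0 0 i + (a * r + b * r') * s^-1 * D).
  by move: (s^-1) D => u D; ring.
by rewrite -/s divff ?gt_eqF// mul1r /D; ring.
Qed.

Lemma mink_convex_body a K b L : 0 <= a -> 0 <= b -> 0 < a + b ->
  convex_body K -> convex_body L -> convex_body (mink a K b L).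
Proof.
move=> a0 b0 ab bK bL.
have [x0 [r [r0 rK]]] := convex_body_box bK.
have [y0 [r' [r'0 rL]]] := convex_body_box bL.
have s0 : 0 < a * r + b * r'.
  have ar0 : 0 <= a * r by rewrite mulr_ge0// ltW.
  have br0 : 0 <= b * r' by rewrite mulr_ge0// ltW.
  have [a'|a'] : 0 < a \/ 0 < b by case: (ltrP 0 a) => ?; [left|right; lra].
    by have := mulr_gt0 a' r0; lra.
  by have := mulr_gt0 a' r'0; lra.
apply: (convex_bodyI _ (mink_conv bK bL) s0 (mink_box a0 b0 s0 r0 r'0 rK rL)).
by apply: mink_compact; exact: convex_body_compact.
Qed.

Lemma mink_dilate l a K b L : mink (l * a) K (l * b) L = dilate l 0 (mink a K b L).
Proof.
apply/seteqP; split=> [_ [x Kx [y Ly <-]]|_ [_ [x Kx [y Ly <-]] <-]].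
  exists (a *: x + b *: y); first by exists x => //; exists y.
  by rewrite addr0 scalerDr !scalerA.
by exists x => //; exists y => //; rewrite addr0 scalerDr !scalerA.
Qed.

Lemma volR_mink_scale l a K b L : 0 < l -> 0 <= a -> 0 <= b -> 0 < a + b ->
  convex_body K -> convex_body L ->
  volR (mink (l * a) K (l * b) L) = l ^+ n * volR (mink a K b L).
Proof.
by move=> l0 a0 b0 ab bK bL; rewrite mink_dilate volR_dilate//; exact: mink_convex_body.
Qed.

Lemma mink_translate a x K b y L :
  mink a (dilate 1 x K) b (dilate 1 y L) = dilate 1 (a *: x + b *: y) (mink a K b L).
Proof.
apply/seteqP; split=> [_ [_ [u Ku <-] [_ [v Lv <-] <-]]|_ [_ [u Ku [v Lv <-]] <-]].
  exists (a *: u + b *: v); first by exists u => //; exists v.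
  by rewrite !scale1r !scalerDr addrACA.
exists (u + x); first by exists u; rewrite // scale1r.
exists (v + y); first by exists v; rewrite // scale1r.
by rewrite !scale1r !scalerDr addrACA.
Qed.

Lemma volR_mink_translate a x K b y L : 0 <= a -> 0 <= b -> 0 < a + b ->
  convex_body K -> convex_body L ->
  volR (mink a (dilate 1 x K) b (dilate 1 y L)) = volR (mink a K b L).
Proof.
move=> a0 b0 ab bK bL; rewrite mink_translate volR_dilate//.
  by rewrite expr1n mul1r.
exact: mink_convex_body.
Qed.


End minkowski.

(** * Sumsets of lattice points of two bodies *)

Section centred_sumsets.
Context (R : realType) (n : nat) (K L : set 'rV[R]_n) (r : R).
Hypotheses (bK : convex_body K) (bL : convex_body L) (r0 : 0 < r).
Hypotheses (rK : box_around 0 r `<=` K) (rL : box_around 0 r `<=` L).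

Let K0 : K 0. Proof. by apply: rK => i; rewrite subrr normr0 ltW. Qed.
Let L0 : L 0. Proof. by apply: rL => i; rewrite subrr normr0 ltW. Qed.

Variables (m : nat) (A C : seq 'rV[int]_n).
Hypothesis m0 : (0 < m)%N.
Hypothesis A_K : forall q, q \in A <-> K (lattice 0 m%:R^-1 q).
Hypothesis C_L : forall q, q \in C <-> L (lattice 0 m%:R^-1 q).

Let mR0 : 0 < m%:R :> R. Proof. by rewrite ltr0n. Qed.

Lemma mem_gens (c : bool) z :
  ((c, z) \in gens A C) = if c then z \in C else z \in A.
Proof.
rewrite mem_cat; case: c.
  rewrite (_ : (_ \in map (pair false) A) = false) ?mem_map//; first by move=> ? ? [].
  by apply/mapP => -[].
by rewrite mem_map ?[X in _ || X](_ : _ = false) ?orbF//; [apply/mapP => -[]|move=> ? ? []].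
Qed.

Lemma latticeD h (p q : 'rV[int]_n) :
  lattice 0 h (p + q) = lattice 0 h p + lattice 0 h q :> 'rV[R]_n.
Proof. by apply/rowP => i; rewrite !mxE intrD; ring. Qed.

(** Adds one more point to a sum of k points of a convex set. *)
Lemma conv_succ M k (x y : 'rV[R]_n) : convex_body M -> M x -> M y ->
  exists2 z, M z & x + k%:R *: y = k.+1%:R *: z.
Proof.
move=> bM Mx My; have k0 : 0 < k.+1%:R :> R by rewrite ltr0n.
exists (k.+1%:R^-1 *: x + (1 - k.+1%:R^-1) *: y).
  by apply: convex_body_conv => //; rewrite ?invr_ge0 ?ler0n// invf_le1// ler1n.
apply/rowP => i; rewrite !mxE -[k.+1]addn1 natrD; field.
by rewrite -natr1 in k0; rewrite gt_eqF.
Qed.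

Lemma sumset_sub k l q : q \in sumset A C k l ->
  mink k%:R K l%:R L (lattice 0 m%:R^-1 q).
Proof.
move: k l q; apply: sumset_ind => [|c z k l q].
  by exists 0 => //; exists 0 => //; apply/rowP => i; rewrite !mxE; ring.
rewrite mem_gens latticeD => + [x Kx [y Ly <-]]; case: c => [/C_L|/A_K] Mz.
  have [w Lw wE] := conv_succ l bL Mz Ly.
  by exists x => //; exists w => //; rewrite -wE addrCA.
have [w Kw wE] := conv_succ k bK Mz Kx.
by exists w => //; exists y => //; rewrite -wE addrA.
Qed.

Definition corner (p e : 'rV[int]_n) := forall i, p 0 i <= e 0 i <= p 0 i + 1.

(** If all corners of a unit cube are available as summands, then sums of j of
them reach every integer point of the cube scaled by j: each step removes one
unit from the coordinates of e that are equal to j. *)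
Lemma sumset_corners (c : bool) p k l q :
  (forall z, corner p z -> (c, z) \in gens A C) -> q \in sumset A C k l ->
  forall j (e : 'rV[int]_n), (forall i, (0 <= e 0 i :> int) && (e 0 i <= j%:Z)) ->
  p *+ j + e + q \in
    sumset A C (if c then k else (j + k)%N) (if c then (j + l)%N else l).
Proof.
move=> pA qkl; elim=> [|j IH] e eP.
  have -> : e = 0 by apply/rowP => i; rewrite mxE; have := eP i; lia.
  by rewrite mulr0n !add0r; case: (c).
pose z : 'rV[int]_n := \row_i (if e 0 i == j.+1%:Z then 1 else 0).
have -> : p *+ j.+1 + e + q = (p + z) + (p *+ j + (e - z) + q).
  by rewrite mulrS; apply/rowP => i; rewrite !mxE; ring.
have := sumsetD (pA (p + z) _) (IH (e - z) _); rewrite !addSn; case: (c); apply.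
- by move=> i; rewrite !mxE; move: (p 0 i) => u; case: ifP => _; lia.
- move=> i; rewrite !mxE; have := eP i; move: (e 0 i) => u.
  by case: ifP => [/eqP ->|/eqP]; lia.
- by move=> i; rewrite !mxE; move: (p 0 i) => u; case: ifP => _; lia.
- move=> i; rewrite !mxE; have := eP i; move: (e 0 i) => u.
  by case: ifP => [/eqP ->|/eqP]; lia.
Qed.

Let floorv (x : 'rV[R]_n) : 'rV[int]_n := \row_i Num.floor (m%:R * x 0 i).

Let th : R := 1 - (m%:R * r)^-1.
Hypothesis mr1 : 1 < m%:R * r.

Let floor_corner M x z : convex_body M -> box_around 0 r `<=` M -> M x ->
  corner (floorv (th *: x)) z -> M (lattice 0 m%:R^-1 z).
Proof.
move=> bM rM Mx zx.
(* the point of the box for which z / m = th x + (1 - th) w *)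
pose w := (m%:R * r) *: (lattice 0 m%:R^-1 z - th *: x).
have mr0 : 0 < m%:R * r by rewrite mulr_gt0.
have -> : lattice 0 m%:R^-1 z = th *: x + (1 - th) *: w.
  by apply/rowP => i; rewrite /w !mxE /th; field; rewrite !gt_eqF.
have mr_gt0 : 0 < (m%:R * r)^-1 by rewrite invr_gt0.
have mr_lt1 : (m%:R * r)^-1 < 1 by rewrite invf_lt1.
apply: (convex_body_conv bM) => //; [|rewrite /th; lra|rewrite /th; lra].
apply: rM => i; rewrite [X in _ - X]mxE subr0.
have := zx i; rewrite /floorv /w mxE => zi; rewrite !mxE add0r.
have /andP[f1 f2] := floor_itv (m%:R * (th *: x) 0 i).
set f := Num.floor _ in zi f1 f2.
rewrite mxE in f1; rewrite mxE in f2.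
have z1 : f%:~R <= (z 0 i)%:~R :> R by rewrite ler_int; case/andP: zi.
have z2 : (z 0 i)%:~R <= (f + 1)%:~R :> R by rewrite ler_int; case/andP: zi.
rewrite intrD in z2 f2.
rewrite (_ : _ * _ = r * ((z 0 i)%:~R - m%:R * (th * x 0 i))); last first.
  by field; rewrite gt_eqF.
rewrite normrM (gtr0_norm r0) ler_piMr ?(ltW r0)// ler_norml.
by apply/andP; split; lra.
Qed.

(** The integer points of m(kK + lL), shrunk a little, are sums of k points of
A and l points of C. Indeed if q is k x + l y with x in th m K and y in th m L,
then all corners of the unit cubes that contain x and y lie in mK and mL; the
remaining integer vector e has coordinates between 0 and k + l, and its part up
to k is absorbed by the summands in A, the rest by those in C. *)
Lemma sub_sumset k l q : dilate th 0 (mink k%:R K l%:R L) (lattice 0 m%:R^-1 q) ->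
  q \in sumset A C k l.
Proof.
move=> [_ [x Kx [y Ly <-]]]; rewrite addr0 scalerDr => qE.
pose p1 := floorv (th *: x); pose p2 := floorv (th *: y).
pose e := q - p1 *+ k - p2 *+ l.
have eP i : (0 <= e 0 i :> int) && (e 0 i <= (k + l)%N%:Z).
  have := congr1 (fun v : 'rV[R]_n => m%:R * v 0 i) qE.
  rewrite !mxE add0r mulVKf ?gt_eqF// => {}qE.
  have /andP[f1 f2] := floor_itv (m%:R * (th *: x) 0 i).
  have /andP[g1 g2] := floor_itv (m%:R * (th *: y) 0 i).
  rewrite !mulmxnE !mxE; rewrite !mxE in f1 f2 g1 g2.
  set f := Num.floor _ in f1 f2 *; set g := Num.floor _ in g1 g2 *.
  have k0 : 0 <= k%:R :> R by []. have l0 : 0 <= l%:R :> R by [].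
  rewrite -(ler_int R) -[in X in _ && X](ler_int R) !rmorphB /= !rmorphMn /=.
  rewrite -qE mulr0z -pmulrn natrD -[_ *+ k]mulr_natl -[_ *+ l]mulr_natl; rewrite !intrD in f2 g2.
  have u1 : 0 <= m%:R * (th * x 0 i) - f%:~R by lra.
  have u2 : 0 <= f%:~R + 1 - m%:R * (th * x 0 i) by lra.
  have v1 : 0 <= m%:R * (th * y 0 i) - g%:~R by lra.
  have v2 : 0 <= g%:~R + 1 - m%:R * (th * y 0 i) by lra.
  have := mulr_ge0 k0 u1; have := mulr_ge0 k0 u2.
  have := mulr_ge0 l0 v1; have := mulr_ge0 l0 v2.
  by move=> *; apply/andP; split; lra.
pose e1 : 'rV[int]_n := \row_i Order.min (e 0 i) k%:Z.
have -> : q = p1 *+ k + e1 + (p2 *+ l + (e - e1) + 0).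
  by apply/rowP => i; rewrite !mxE; ring.
have h2 := @sumset_corners true p2 0 0 0 _ (sumset00 A C) l (e - e1) _.
rewrite addn0 in h2; have h1 := @sumset_corners false p1 0 l _ _ (h2 _ _) k e1 _.
rewrite !addn0 in h1; apply: h1.
- by move=> z zp; rewrite mem_gens; apply/A_K; exact: floor_corner zp.
- by move=> z zp; rewrite mem_gens; apply/C_L; exact: floor_corner zp.
- by move=> i; rewrite !mxE; have := eP i; rewrite !mxE; lia.
- by move=> i; rewrite !mxE; have := eP i; rewrite !mxE; lia.
Qed.

End centred_sumsets.

(** * Limits of polynomials *)

Section polynomial_limits.
Context (R : realType).
Implicit Types (p : {poly R}).

Lemma cvg_scaled_harmonic (c : R) : (fun N => c * harmonic N) @ \oo --> (0 : R).
Proof. by rewrite -(mulr0 c); apply: cvgMr; exact: cvg_harmonic. Qed.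

Lemma cvg_poly_harmonic p (c : R) :
  (fun N => p.[c * harmonic N]) @ \oo --> p.[0].
Proof.
exact: (continuous_cvg _ (@continuous_horner R p 0) (cvg_scaled_harmonic c)).
Qed.

Lemma cvg_lead_ratio p d : (size p <= d.+1)%N ->
  (fun N => p.[N.+1%:R] / N.+1%:R ^+ d) @ \oo --> p`_d.
Proof.
elim: d p => [|d IHd] p sp.
  rewrite (size1_polyC sp) coefC eqxx; apply: cvg_near_cst.
  by apply: nearW => N; rewrite hornerC expr0 divr1.
have {sp} [q [c [-> sq]]] : exists q c, p = q * 'X + c%:P /\ (size q <= d.+1)%N.
  elim/poly_ind: p sp => [|q c _] sp.
    by exists 0, 0; rewrite mul0r add0r size_poly0.
  exists q, c; split=> //; have [->|q0] := eqVneq q 0; first by rewrite size_poly0.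
  by move: sp; rewrite -cons_poly_def size_cons_poly nil_poly (negbTE q0) /=.
have -> : (q * 'X + c%:P)`_d.+1 = q`_d + c * 0 by rewrite coefD coefMX coefC mulr0 /= addr0.
have N0 N : N.+1%:R != 0 :> R by rewrite pnatr_eq0.
have -> : (fun N => (q * 'X + c%:P).[N.+1%:R] / N.+1%:R ^+ d.+1) =
    (fun N => q.[N.+1%:R] / N.+1%:R ^+ d + c * ('X^(d.+1)).[1 * harmonic N]).
  apply/funext => N; rewrite hornerMXaddC hornerXn mul1r /harmonic exprVn exprS.
  by rewrite mulrDl invfM mulrA mulfK.
apply: cvgD; first exact: IHd.
apply: cvgMr; have := @cvg_poly_harmonic 'X^(d.+1) 1.
by rewrite hornerXn expr0n.
Qed.

(** A polynomial that grows at most like N^n has degree at most n, so this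
ratio tends to the coefficient of degree n, possibly 0. *)
Lemma cvg_growth_ratio p n B N0 :
  (forall N, (N0 <= N)%N -> `|p.[N.+1%:R]| <= B * N.+1%:R ^+ n) ->
  (fun N => p.[N.+1%:R] / N.+1%:R ^+ n) @ \oo --> p`_n.
Proof.
move=> pB; apply: cvg_lead_ratio; rewrite leqNgt; apply/negP => np.
pose d := (size p).-1; have dE : size p = d.+1 by rewrite prednK// (leq_trans _ np).
have nd : (n < d)%N by rewrite -ltnS -dE.
have := @cvg_lead_ratio p d; rewrite dE => /(_ (leqnn _)) lim1.
have lim2 : (fun N => p.[N.+1%:R] / N.+1%:R ^+ d) @ \oo --> (0 : R).
  pose g N := B * ('X^(d - n)).[1 * harmonic N] : R.
  have g0 : g @ \oo --> (0 : R).
    rewrite -(mulr0 B); apply: cvgMr; have := @cvg_poly_harmonic 'X^(d - n) 1.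
    by rewrite hornerXn expr0n subn_eq0 leqNgt nd.
  apply: (@squeeze_cvgr _ _ _ _ (fun N => - g N) g) => //; last first.
    by rewrite -oppr0; exact: cvgN.
  exists N0 => // N /= /pB; rewrite -ler_norml normrM (@ger0_norm _ (_^-1)); last first.
    by rewrite invr_ge0 exprn_ge0.
  rewrite /g hornerXn mul1r /harmonic exprVn -(subnK (ltnW nd)) addnK exprD => pBN.
  by rewrite ler_pdivrMr ?mulr_gt0 ?exprn_gt0// mulrA mulfVK// expf_neq0.
have /eqP : p`_d = 0 by apply: cvg_unique lim1 lim2; exact: norm_hausdorff.
by rewrite -lead_coefE lead_coef_eq0 -size_poly_eq0 dE.
Qed.

(** A polynomial of size at most d is determined by its values at d points,
through Lagrange interpolation; the interpolation of the limits is the limit.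
*)
Lemma poly_pointwise_limit (F : nat -> {poly R}) d (X : set R) (f : R -> R)
    (x : nat -> R) :
  injective x -> (forall i, X (x i)) -> (forall m, (size (F m) <= d)%N) ->
  (forall u, X u -> (fun m => (F m).[u]) @ \oo --> f u) ->
  exists2 p : {poly R}, (size p <= d)%N & forall u, X u -> f u = p.[u].
Proof.
case: d => [|d] xinj xX sF Ff.
  exists 0; rewrite ?size_poly0// => u Xu; rewrite horner0.
  apply: (cvg_unique (@norm_hausdorff _ _) (Ff u Xu)); apply: cvg_near_cst; apply: nearW => m.
  by have := sF m; rewrite leqn0 size_poly_eq0 => /eqP->; rewrite horner0.
exists (\sum_(i < d.+1) (f (x i))%:P * (tnth (qpoly.lagrange d.+1 x) i : {poly R})).
  apply: (leq_trans (size_sum _ _ _)); apply/bigmax_leqP => i _.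
  by rewrite mul_polyC (leq_trans (size_scale_leq _ _))// qpoly.size_lagrange_.
move=> u Xu; rewrite horner_sum.
apply: (cvg_unique (@norm_hausdorff _ _) (Ff u Xu)).
rewrite (_ : (fun m => (F m).[u]) = (fun m => \sum_(i < d.+1)
    (F m).[x i] * (tnth (qpoly.lagrange d.+1 x) i : {poly R}).[u])); last first.
  apply/funext => m; rewrite {1}(qpoly.lagrange_gen (x := x) (n := d.+1) _ xinj (sF m))//.
  by rewrite horner_sum; apply: eq_bigr => i _; rewrite hornerM hornerC.
apply: cvg_big => [|i _]; first exact: add_continuous.
rewrite hornerM hornerC; by apply: cvgMl; exact: Ff.
Qed.

End polynomial_limits.

(** * Mixed volumes of two bodies *)

Section centred_forms.
Context (R : realType) (n : nat) (K L : set 'rV[R]_n) (r : R).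
Hypotheses (bK : convex_body K) (bL : convex_body L) (r0 : 0 < r).
Hypotheses (rK : box_around 0 r `<=` K) (rL : box_around 0 r `<=` L).

Lemma lattice_mink_scale m N k l (q : 'rV[int]_n) : (0 < m)%N -> (0 < N)%N ->
  mink (N * k)%:R K (N * l)%:R L (lattice 0 m%:R^-1 q) <->
  mink k%:R K l%:R L (lattice 0 (m%:R^-1 * N%:R^-1) q).
Proof.
move=> m0 N0; rewrite !natrM mink_dilate.
have NR : N%:R != 0 :> R by rewrite pnatr_eq0 -lt0n.
have -> : lattice 0 m%:R^-1 q =
    N%:R *: lattice 0 (m%:R^-1 * N%:R^-1) q + 0 :> 'rV[R]_n.
  by apply/rowP => i; rewrite !mxE; field; rewrite NR pnatr_eq0 -lt0n.
split=> [[x Mx /addIr/scalerI]|Mx]; last by exists (lattice 0 (m%:R^-1 * N%:R^-1) q).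
by move=> <-.
Qed.

(** For fixed m, the sumset of the lattice points of mK and mL with weights Nk,
Nl has size P(N) for a polynomial P; divided by N^n it tends to the coefficient
of degree n in P, a form in (k, l), and [sumset_sub], [sub_sumset] and
[lattice_bounds] enclose this limit. *)
Lemma form_bounds m : 1 < m%:R * r -> exists c : nat -> R, forall k l,
  (0 < k)%N -> (0 < l)%N ->
  (1 - (m%:R * r)^-1) ^+ n * volR (mink k%:R K l%:R L) <=
    \sum_(i < n.+1) c i * k%:R ^+ (n - i) * l%:R ^+ i <=
  volR (mink k%:R K l%:R L).
Proof.
move=> mr1; have mR0 : 0 < m%:R :> R by rewrite -(pmulr_lgt0 _ r0) (lt_trans _ mr1).
have m0 : (0 < m)%N by rewrite -(ltr0n R).
have mV0 : 0 < m%:R^-1 :> R by rewrite invr_gt0.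
have [cK cKP] := compact_bounded_by (convex_body_compact bK).
have [cL cLP] := compact_bounded_by (convex_body_compact bL).
have [A uA AP] := lattice_enum 0 cKP mV0.
have [C uC CP] := lattice_enum 0 cLP mV0.
have [t [N0 tP]] := @tame_poly R _ (tame_sumset A C).
exists (fun i => m%:R^-1 ^+ n * form_coef t n i) => k l k0 l0.
set v := volR _; set th := 1 - _.
have -> : \sum_(i < n.+1) m%:R^-1 ^+ n * form_coef t n i * k%:R ^+ (n - i) * l%:R ^+ i =
    m%:R^-1 ^+ n * (ray_poly t k%:R l%:R)`_n.
  by rewrite coef_ray_poly mulr_sumr; apply: eq_bigr => i _; rewrite !mulrA.
set P := ray_poly t _ _.
pose S N := sumset A C (N.+1 * k) (N.+1 * l).
have PE N : (N0 <= N)%N -> P.[N.+1%:R] = (size (S N))%:R.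
  move=> NN0; rewrite tP ?horner_ray_poly; first by apply: eq_bigr => p _;
    rewrite !natrM ![_ * N.+1%:R]mulrC.
    by rewrite (leq_trans NN0)// (leq_trans (leqnSn _))// leq_pmulr.
  by rewrite (leq_trans NN0)// (leq_trans (leqnSn _))// leq_pmulr.
pose M := mink k%:R K l%:R L.
have kl0 : 0 < k%:R + l%:R :> R by rewrite -natrD ltr0n addn_gt0 k0.
have bM : convex_body M by apply: mink_convex_body.
pose s := k%:R * r + l%:R * r.
have s0 : 0 < s by rewrite /s -mulrDl mulr_gt0.
have sM : box_around 0 s `<=` M.
  have := @mink_box _ _ k%:R K l%:R L 0 0 r r _ _ s0 r0 r0 rK rL.
  by rewrite !scaler0 addr0; apply.
have th0 : 0 < th by rewrite subr_gt0 invf_lt1// (lt_trans _ mr1).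
have v0 : 0 <= v by exact: volR_ge0.
pose h N : R := m%:R^-1 * harmonic N.
have h0 N : 0 < h N by rewrite mulr_gt0// invr_gt0.
have ms : m%:R^-1 < s.
  rewrite -[_^-1]mul1r ltr_pdivrMr// mulrC (lt_le_trans mr1)// ler_pM2l//.
  by rewrite /s -mulrDl ler_peMl ?(ltW r0)// -natrD ler1n addn_gt0 k0.
have hs N : h N < s.
  by rewrite (le_lt_trans _ ms)// ler_piMr ?(ltW mV0)// invf_le1// ler1n.
have hn N x : x * h N ^+ n = m%:R^-1 ^+ n * (x / N.+1%:R ^+ n).
  by rewrite /h exprMn /harmonic [N.+1%:R^-1 ^+ _]exprVn; ring.
have upper N : (size (S N))%:R * h N ^+ n <= (1 + h N / s) ^+ n * v.
  have [cM cMP] := compact_bounded_by (convex_body_compact bM).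
  have [e ue eP] := lattice_enum 0 cMP (h0 N).
  have [le_e _] := lattice_bounds bM s0 sM (h0 N) (hs N) ue eP.
  apply: le_trans le_e; rewrite ler_pM2r ?exprn_gt0// ler_nat.
  apply: uniq_leq_size; first exact: sumset_uniq.
  move=> q /(sumset_sub bK bL r0 rK rL AP CP) qM.
  by apply/eP/(lattice_mink_scale k l q m0 (ltn0Sn N)).
have lower N : h N < th * s ->
    (1 - h N / (th * s)) ^+ n * (th ^+ n * v) <= (size (S N))%:R * h N ^+ n.
  move=> hts; have bD := dilate_convex_body 0 th0 bM.
  have sD := @dilate_box _ _ th 0 M 0 s th0 sM; rewrite scaler0 addr0 in sD.
  have [cD cDP] := compact_bounded_by (convex_body_compact bD).
  have [e ue eP] := lattice_enum 0 cDP (h0 N).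
  have ts0 : 0 < th * s by rewrite mulr_gt0.
  have [_] := lattice_bounds bD ts0 sD (h0 N) hts ue eP.
  rewrite volR_dilate// => le_e.
  apply: (le_trans le_e); rewrite ler_pM2r ?exprn_gt0// ler_nat.
  apply: uniq_leq_size => // q /eP qD.
  apply: (sub_sumset bK bL r0 rK rL m0 AP CP mr1).
  have [x Mx xE] := qD; exists (N.+1%:R *: x).
    by rewrite !natrM mink_dilate; exists x => //; rewrite addr0.
  apply/rowP => i; have := congr1 (fun y : 'rV[R]_n => y 0 i) xE.
  rewrite !mxE /h /harmonic => xE'; rewrite !addr0 !add0r in xE' *.
  rewrite -/th mulrCA xE' /= [m%:R^-1 * _]mulrC -!mulrA mulVKf// pnatr_eq0//.
have limP : (fun N => P.[N.+1%:R] / N.+1%:R ^+ n) @ \oo --> P`_n.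
  apply: (@cvg_growth_ratio _ _ _ (m%:R ^+ n * (2 ^+ n * v)) N0) => N NN0.
  rewrite PE// ger0_norm// -ler_pdivrMr ?exprn_gt0// -ler_pdivrMl ?exprn_gt0//.
  rewrite -exprVn -hn (le_trans (upper N))// ler_wpM2r//.
  apply: lerXn2r; rewrite ?nnegrE ?addr_ge0 ?divr_ge0 ?ltW//.
  by rewrite -[2]/(1 + 1) ltrD2l ltr_pdivrMr// mul1r.
have limS : (fun N => m%:R^-1 ^+ n * (P.[N.+1%:R] / N.+1%:R ^+ n)) @ \oo -->
    m%:R^-1 ^+ n * P`_n by exact: cvgMr.
apply/andP; split.
  pose Q : {poly R} := (1%:P - (th * s)^-1 *: 'X) ^+ n * (th ^+ n * v)%:P.
  have QE e : Q.[e] = (1 - e / (th * s)) ^+ n * (th ^+ n * v).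
    rewrite /Q hornerM horner_exp hornerD hornerN hornerZ hornerX !hornerC.
    by rewrite [_ * e]mulrC.
  have := @cvg_poly_harmonic _ Q m%:R^-1.
  rewrite QE mul0r subr0 expr1n mul1r => limQ.
  apply: (ler_cvg_to limQ limS).
  have hto0 := @cvg_scaled_harmonic R m%:R^-1.
  have ts0 : 0 < th * s by rewrite mulr_gt0.
  near=> N; rewrite QE PE; last by near: N; exact: nbhs_infty_ge.
  rewrite -hn; apply: lower; near: N; exact: (cvgr_lt _ hto0 _ ts0).
pose Q : {poly R} := (1%:P + s^-1 *: 'X) ^+ n * v%:P.
have QE e : Q.[e] = (1 + e / s) ^+ n * v.
  by rewrite /Q hornerM horner_exp hornerD hornerZ hornerX !hornerC [_ * e]mulrC.
have := @cvg_poly_harmonic _ Q m%:R^-1.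
rewrite QE mul0r addr0 expr1n mul1r => limQ.
apply: (ler_cvg_to limS limQ); near=> N.
by rewrite QE PE -?hn; [exact: upper | near: N; exact: nbhs_infty_ge].
Unshelve. all: by end_near. Qed.

End centred_forms.

Section mixed_volumes.
Context (R : realType) (n : nat).
Implicit Types (K L : set 'rV[R]_n).

Lemma positive_ratP (u : rat) : 0 < u ->
  exists k l : nat, [/\ (0 < k)%N, (0 < l)%N & ratr u = l%:R / k%:R :> R].
Proof.
move=> u0; have nu : 0 < numq u by rewrite numq_gt0.
exists `|denq u|%N, `|numq u|%N; rewrite !absz_gt0 denq_neq0 gt_eqF//; split=> //.
by rewrite /ratr !pmulrn !gtz0_abs ?denq_gt0.
Qed.

(** Let m tend to infinity in [form_bounds] and interpolate. Only rational
weights arise from integer multiples. *)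
Lemma centred_mixed_rat K L (r : R) : convex_body K -> convex_body L -> 0 < r ->
  box_around 0 r `<=` K -> box_around 0 r `<=` L ->
  exists2 p : {poly R}, (size p <= n.+1)%N & forall u : rat, 0 < u ->
    volR (mink 1 K (ratr u) L) = p.[ratr u].
Proof.
move=> bK bL r0 rK rL.
(* form_bounds needs m r > 1; the indices m + m0 + 1 satisfy it *)
pose m0 := (Num.bound r^-1).
have mr m : 1 < (m + m0).+1%:R * r.
  rewrite -ltr_pdivrMr// mul1r; apply: (@lt_le_trans _ _ m0%:R).
    by rewrite archi_boundP// invr_ge0 ltW.
  by rewrite ler_nat leqW// leq_addl.
have [c cP] := choice (fun m => form_bounds bK bL r0 rK rL (mr m)).
pose F m : {poly R} := \poly_(i < n.+1) c m i.
have [||||p sp pE] := @poly_pointwise_limit R F n.+1 [set u | exists2 v : rat, 0 < v & u = ratr v]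
    (fun u => volR (mink 1 K u L)) (fun i => i.+1%:R).
- by move=> i j /eqP; rewrite eqr_nat => /eqP[].
- by move=> i; exists i.+1%:R; rewrite ?ltr0n// ratr_nat.
- by move=> m; exact: size_poly.
- move=> _ [v v0 ->]; have [k [l [k0 l0 vE]]] := positive_ratP v0.
  have kR : 0 < k%:R :> R by rewrite ltr0n.
  pose V := volR (mink 1 K (ratr v) L).
  have VE : volR (mink k%:R K l%:R L) = k%:R ^+ n * V.
    have rv0 : 0 <= ratr v :> R by rewrite ler0q ltW.
    have rv1 : 0 < 1 + ratr v :> R by rewrite ltr_wpDr.
    rewrite /V -(volR_mink_scale kR ler01 rv0 rv1 bK bL) mulr1 vE.
    by rewrite mulrCA divff ?mulr1// gt_eqF.
  have FE m : \sum_(i < n.+1) c m i * k%:R ^+ (n - i) * l%:R ^+ i =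
      k%:R ^+ n * (F m).[ratr v].
    rewrite horner_poly mulr_sumr; apply: eq_bigr => i _.
    have -> : k%:R ^+ n = k%:R ^+ (n - i) * k%:R ^+ i :> R.
      by rewrite -exprD subnK// -ltnS.
    by rewrite vE expr_div_n; field; rewrite expf_neq0// gt_eqF.
  have bnd m : (1 - ((m + m0).+1%:R * r)^-1) ^+ n * V <= (F m).[ratr v] <= V.
    have := cP m k l k0 l0; rewrite VE FE mulrCA.
    by rewrite !ler_pM2l ?exprn_gt0.
  apply: (@squeeze_cvgr _ _ _ _ (fun m => (1 - ((m + m0).+1%:R * r)^-1) ^+ n * V) (fun=> V)).
  + by apply: nearW => m; exact: bnd.
  + pose Q : {poly R} := (1%:P - 'X) ^+ n * V%:P.
    have QE e : Q.[e] = (1 - e) ^+ n * V.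
      by rewrite /Q hornerM horner_exp hornerD hornerN hornerX !hornerC.
    have := @cvg_poly_harmonic _ Q r^-1; rewrite QE subr0 expr1n mul1r.
    rewrite -(cvg_shiftn m0); apply: cvg_trans; apply: near_eq_cvg.
    by apply: nearW => m /=; rewrite QE /harmonic /= invfM [r^-1 * _]mulrC.
  + exact: cvg_cst.
by exists p => // u u0; apply: pE; exists u.
Qed.

(** The binary form of degree n that dehomogenizes to p. *)
Definition homog_form (p : {poly R}) (a b : R) : R :=
  \sum_(i < n.+1) p`_i * a ^+ (n - i) * b ^+ i.

Lemma homog_formE (p : {poly R}) a b : (size p <= n.+1)%N -> a != 0 ->
  homog_form p a b = a ^+ n * p.[b / a].
Proof.
move=> sp a0; rewrite (horner_coef_wide _ sp) mulr_sumr; apply: eq_bigr => i _.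
have -> : a ^+ n = a ^+ (n - i) * a ^+ i by rewrite -exprD subnK// -ltnS.
by rewrite expr_div_n; field; rewrite expf_neq0.
Qed.

Lemma cvg_homog_form (p : {poly R}) (u v : nat -> R) a b :
  u @ \oo --> a -> v @ \oo --> b ->
  (fun j => homog_form p (u j) (v j)) @ \oo --> homog_form p a b.
Proof.
move=> ua vb; apply: cvg_big => [|i _]; first exact: add_continuous.
apply: cvgM; first apply: cvgM; first exact: cvg_cst.
  exact: (continuous_cvg _ (@exprn_continuous R (n - i) a) ua).
exact: (continuous_cvg _ (@exprn_continuous R i b) vb).
Qed.

Section squeeze.
Variables (K L : set 'rV[R]_n) (r c : R).
Hypotheses (bK : convex_body K) (bL : convex_body L) (r0 : 0 < r).
Hypotheses (rK : box_around 0 r `<=` K) (rL : box_around 0 r `<=` L).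
Hypotheses (Kc : bounded_by K c) (Lc : bounded_by L c) (c0 : 0 < c).

Lemma shrink (M : set 'rV[R]_n) x (t : R) : convex_body M -> box_around 0 r `<=` M -> M x ->
  0 <= t <= 1 -> M (t *: x).
Proof.
move=> bM rM Mx /andP[t0 t1]; rewrite -[t *: x]addr0 -(scaler0 _ (1 - t)).
by apply: convex_body_conv => //; apply: rM => i; rewrite subrr normr0 ltW.
Qed.

Lemma mink_le (a b a' b' : R) : 0 <= a -> 0 <= b -> a < a' -> b < b' ->
  mink a K b L `<=` mink a' K b' L.
Proof.
move=> a0 b0 aa' bb' _ [x Kx [y Ly <-]].
have a'0 : 0 < a' by rewrite (le_lt_trans a0).
have b'0 : 0 < b' by rewrite (le_lt_trans b0).
exists ((a / a') *: x).
  by apply: shrink => //; rewrite divr_ge0 ?(ltW a'0)//= ler_pdivrMr// mul1r ltW.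
exists ((b / b') *: y).
  by apply: shrink => //; rewrite divr_ge0 ?(ltW b'0)//= ler_pdivrMr// mul1r ltW.
by rewrite !scalerA !(mulrC _ (_ / _)) !mulfVK ?gt_eqF.
Qed.

(** The excess of the larger combination over a x + b y is small, hence a small
multiple of a point of aK + bL, which contains a box around 0. *)
Lemma mink_ge (a b a' b' e : R) : 0 <= a -> 0 <= b -> 0 < a + b -> 0 < e ->
  a < a' < a + e -> b < b' < b + e ->
  mink a' K b' L `<=` dilate (1 + 2 * c / (a * r + b * r) * e) 0 (mink a K b L).
Proof.
move=> a0 b0 ab e0 /andP[a1 a2] /andP[b1 b2] _ [x Kx [y Ly <-]].
set s := a * r + b * r; have s0 : 0 < s by rewrite /s -mulrDl mulr_gt0.
pose k := 2 * c / s * e; have k0 : 0 < k.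
  by rewrite /k mulr_gt0 ?divr_gt0 ?mulr_gt0.
pose w := k^-1 *: ((a' - a) *: x + (b' - b) *: y).
have Mw : mink a K b L w.
  have := @mink_box _ _ a K b L 0 0 r r a0 b0 s0 r0 r0 rK rL.
  rewrite !scaler0 addr0; apply => i; rewrite !mxE subr0.
  rewrite normrM gtr0_norm ?invr_gt0// mulrC ler_pdivrMr//.
  have -> : (a * r + b * r) * k = 2 * c * e by rewrite /k -/s; field; rewrite gt_eqF.
  rewrite (le_trans (ler_normD _ _))// !normrM (@gtr0_norm _ (a' - a)) ?subr_gt0//.
  rewrite (@gtr0_norm _ (b' - b)) ?subr_gt0//.
  have ex : (a' - a) * `|x 0 i| <= e * c.
    by rewrite ler_pM ?normr_ge0 ?subr_ge0 ?(ltW a1)//; [lra | exact: Kc].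
  have ey : (b' - b) * `|y 0 i| <= e * c.
    by rewrite ler_pM ?normr_ge0 ?subr_ge0 ?(ltW b1)//; [lra | exact: Lc].
  lra.
exists ((1 + k)^-1 *: (a *: x + b *: y) + (1 - (1 + k)^-1) *: w).
  have k1 : 0 < 1 + k by rewrite addr_gt0.
  apply: mink_conv => //; first by exists x => //; exists y.
    by rewrite invr_ge0 ltW.
  by rewrite invf_le1// lerDl ltW.
rewrite -/k addr0; apply/rowP => i; rewrite !mxE; field.
by rewrite !gt_eqF// addr_gt0.
Qed.

(** Real weights are approached from above by rational ones; [mink_le] and
[mink_ge] squeeze the volume, weights equal to 0 included. *)
Lemma centred_mixed : exists p : {poly R}, forall a b, 0 <= a -> 0 <= b -> 0 < a + b ->
  volR (mink a K b L) = homog_form p a b.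
Proof.
have [p sp pE] := centred_mixed_rat bK bL r0 rK rL.
exists p => a b a0 b0 ab.
have near_rat (x : R) : exists u : nat -> rat, forall j, x < ratr (u j) < x + harmonic j.
  have ex j : exists q, x < ratr q < x + harmonic j.
    have [|q] := @rat_in_itvoo R x (x + harmonic j); first by rewrite ltrDl harmonic_gt0.
    by rewrite in_itv => ?; exists q.
  by have [u uP] := choice ex; exists u.
have [u uP] := near_rat a; have [v vP] := near_rat b.
have lim (x : R) w : (forall j, x < ratr (w j) < x + harmonic j) ->
    (fun j => ratr (w j) : R) @ \oo --> x.
  move=> wP; apply: (@squeeze_cvgr _ _ _ _ (fun=> x) (fun j => x + harmonic j)).
  - by apply: nearW => j; have /andP[/ltW-> /ltW->] := wP j.
  - exact: cvg_cst.
  - by rewrite -[X in _ --> X]addr0; apply: cvgD; [exact: cvg_cst | exact: cvg_harmonic].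
have limF := cvg_homog_form (p := p) (lim _ _ uP) (lim _ _ vP).
pose s := a * r + b * r.
have eqF j : volR (mink (ratr (u j)) K (ratr (v j)) L) = homog_form p (ratr (u j)) (ratr (v j)).
  have u0 : 0 < ratr (u j) :> R by rewrite (le_lt_trans a0)//; case/andP: (uP j).
  have v0 : 0 < ratr (v j) :> R by rewrite (le_lt_trans b0)//; case/andP: (vP j).
  rewrite homog_formE ?gt_eqF// -fmorph_div -pE; last first.
    by rewrite divr_gt0// -(ltr0q R).
  have q0 : 0 <= ratr (v j / u j) :> R by rewrite fmorph_div divr_ge0// ltW.
  have q1 : 0 < 1 + ratr (v j / u j) :> R by rewrite ltr_wpDr.
  rewrite -(volR_mink_scale u0 ler01 q0 q1 bK bL) mulr1 fmorph_div.
  by rewrite mulrCA divff ?mulr1// gt_eqF.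
have bM : convex_body (mink a K b L) by exact: mink_convex_body.
have bMj j : convex_body (mink (ratr (u j)) K (ratr (v j)) L).
  have u0 : 0 < ratr (u j) :> R by rewrite (le_lt_trans a0)//; case/andP: (uP j).
  have v0 : 0 < ratr (v j) :> R by rewrite (le_lt_trans b0)//; case/andP: (vP j).
  by apply: mink_convex_body; rewrite ?addr_gt0 ?ltW.
apply/eqP; rewrite eq_le; apply/andP; split.
  apply: (cvgr_to_ge limF); apply: nearW => j; rewrite -eqF.
  apply: volR_le => //; apply: mink_le => //; first by case/andP: (uP j).
  by case/andP: (vP j).
pose Q : {poly R} := (1%:P + 'X) ^+ n * (volR (mink a K b L))%:P.
have QE e : Q.[e] = (1 + e) ^+ n * volR (mink a K b L).
  by rewrite /Q hornerM horner_exp hornerD hornerX !hornerC.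
have := @cvg_poly_harmonic _ Q (2 * c / s); rewrite QE addr0 expr1n mul1r => limQ.
apply: (ler_cvg_to limF limQ); apply: nearW => j; rewrite QE -eqF.
have k0 : 0 < 1 + 2 * c / s * harmonic j.
  have s0 : 0 < s by rewrite /s -mulrDl mulr_gt0.
  have k0 : 0 < 2 * c / s by apply: divr_gt0 => //; apply: mulr_gt0.
  by rewrite addr_gt0 ?ltr01// mulr_gt0 ?harmonic_gt0.
rewrite -(volR_dilate 0)//; apply: volR_le => //; first exact: dilate_convex_body.
by apply: mink_ge; rewrite ?harmonic_gt0.
Qed.

End squeeze.

(** Translations reduce this to bodies with 0 in their interior. *)
Theorem mixed_volumes K L : convex_body K -> convex_body L ->
  exists p : {poly R}, forall a b, 0 <= a -> 0 <= b -> 0 < a + b ->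
  volR (mink a K b L) = homog_form p a b.
Proof.
move=> bK bL.
have [x0 [rk [rk0 rK]]] := convex_body_box bK.
have [y0 [rl [rl0 rL]]] := convex_body_box bL.
pose K0 := dilate 1 (- x0) K; pose L0 := dilate 1 (- y0) L.
have bK0 : convex_body K0 by exact: dilate_convex_body.
have bL0 : convex_body L0 by exact: dilate_convex_body.
pose r := Num.min rk rl; have r0 : 0 < r by rewrite lt_min rk0.
have rK0 : box_around 0 r `<=` K0.
  apply: subset_trans (@dilate_box _ _ 1 (- x0) K x0 rk ltr01 rK).
  rewrite scale1r subrr mul1r => x xr i; apply: le_trans (xr i) _.
  by rewrite ge_min lexx.
have rL0 : box_around 0 r `<=` L0.
  apply: subset_trans (@dilate_box _ _ 1 (- y0) L y0 rl ltr01 rL).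
  rewrite scale1r subrr mul1r => x xr i; apply: le_trans (xr i) _.
  by rewrite ge_min lexx orbT.
have [ck ckP] := compact_bounded_by (convex_body_compact bK0).
have [cl clP] := compact_bounded_by (convex_body_compact bL0).
pose c := Num.max 1 (Num.max ck cl).
have Kc : bounded_by K0 c.
  by move=> x /ckP xc i; rewrite (le_trans (xc i))// !le_max lexx !orbT.
have Lc : bounded_by L0 c.
  by move=> x /clP xc i; rewrite (le_trans (xc i))// !le_max lexx !orbT.
have c0 : 0 < c by rewrite lt_max ltr01.
have [p pE] := centred_mixed bK0 bL0 r0 rK0 rL0 Kc Lc c0.
by exists p => a b a0 b0 ab; rewrite -pE// volR_mink_translate.
Qed.

End mixed_volumes.

(** * Calculus along curves and symmetry of second derivatives *)

Section one_variable.
Context (R : realType).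

Lemma is_derive_cvg (V : normedModType R) (g : R -> V) t l :
  is_derive t (1 : R) g l <-> h^-1 *: (g (h + t) - g t) @[h --> 0^'] --> l.
Proof.
have E : (fun h : R => h^-1 *: ((g \o shift t) (h *: (1 : R)) - g t)) =
    (fun h => h^-1 *: (g (h + t) - g t)).
  by apply/funext => h /=; rewrite [h%:A]mulr1.
split=> [[dg <-]|lim]; first by rewrite /derivable E in dg; rewrite /derive E.
split; first by rewrite /derivable E; apply/cvg_ex; exists l.
by rewrite /derive E; apply: cvg_lim.
Qed.

Lemma derive_at_continuous (g : R -> R) t l : is_derive t (1 : R) g l ->
  {for t, continuous g}.
Proof. by case=> /derivable1_diffP/differentiable_continuous. Qed.

Lemma mean_value (g dg : R -> R) (a b : R) : a <= b ->
  (forall s, a <= s <= b -> is_derive s (1 : R) g (dg s)) ->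
  exists2 c, a <= c <= b & g b - g a = dg c * (b - a).
Proof.
move=> ab gd; have [||c cab E] := @MVT_segment R g dg a b ab.
- by move=> s; rewrite in_itv => /andP[/ltW ? /ltW ?]; apply: gd; apply/andP.
- apply: continuous_in_subspaceT => s; rewrite inE /= in_itv => sab.
  exact: derive_at_continuous (gd s sab).
by exists c => //; move: cab; rewrite in_itv.
Qed.

Lemma mean_value0 (g dg : R -> R) (v : R) :
  (forall s, `|s| <= `|v| -> is_derive s (1 : R) g (dg s)) ->
  exists2 c, `|c| <= `|v| & g v - g 0 = v * dg c.
Proof.
move=> gd; have [v0|v0] := leP 0 v.
  have [s /andP[s0 sv]|c /andP[c0 cv] E] := @mean_value g dg 0 v v0.
    by apply: gd; rewrite !ger0_norm.
  by exists c; rewrite ?ger0_norm// E subr0 mulrC.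
have [s /andP[vs s0]|c /andP[vc c0] E] := @mean_value g dg v 0 (ltW v0).
  by apply: gd; rewrite !ler0_norm ?(ltW v0)// lerN2.
exists c; first by rewrite !ler0_norm ?(ltW v0)// lerN2.
by rewrite -opprB E; ring.
Qed.

Lemma derive_ge0_le (g dg : R -> R) (b : R) : 0 <= b ->
  (forall s, 0 <= s <= b -> is_derive s (1 : R) g (dg s)) ->
  (forall s, 0 <= s <= b -> 0 <= dg s) -> g 0 <= g b.
Proof.
move=> b0 gd dg0; have [c cb E] := mean_value b0 gd.
by rewrite -subr_ge0 E mulr_ge0 ?dg0// subr0.
Qed.

Lemma derive_uniq (g : R -> R) t l l' :
  is_derive t (1 : R) g l -> is_derive t (1 : R) g l' -> l = l'.
Proof. by move=> [_ <-] [_ <-]. Qed.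

End one_variable.

Section several_variables.
Context (R : realType) (n : nat).
Implicit Types (f : 'rV[R]_n -> R) (x v z d : 'rV[R]_n).
Local Notation e_ i := (delta_mx 0 i : 'rV[R]_n).

Lemma line_derive f z d s : derivable f (z + s *: d) d ->
  is_derive s (1 : R) (fun s : R => f (z + s *: d)) ('D_d f (z + s *: d)).
Proof.
move=> df; apply/is_derive_cvg.
have -> : (fun h : R => h^-1 *: (f (z + (h + s) *: d) - f (z + s *: d))) =
    (fun h => h^-1 *: ((f \o shift (z + s *: d)) (h *: d) - f (z + s *: d))).
  by apply/funext => h /=; rewrite scalerDl addrCA.
exact: df.
Qed.

(** Mean value theorem on each of the n segments that change one coordinate at
a time. *)
Lemma increments f x v :
  (forall z, (forall j, `|z 0 j - x 0 j| <= `|v 0 j|) ->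
    forall i, derivable f z (e_ i)) ->
  exists2 xi : 'I_n -> 'rV[R]_n,
    forall i j, `|xi i 0 j - x 0 j| <= `|v 0 j| &
    f (x + v) - f x = \sum_(i < n) v 0 i * partial i f (xi i).
Proof.
move=> df; pose tr k : 'rV[R]_n := \row_j (if (j < k)%N then v 0 j else 0).
pose w (i : 'I_n) (s : R) := x + tr i + s *: e_ i.
have wP i s : `|s| <= `|v 0 i| -> forall j, `|w i s 0 j - x 0 j| <= `|v 0 j|.
  move=> sv j.
  have -> : w i s 0 j - x 0 j = (if (j < i)%N then v 0 j else 0) + s * (j == i)%:R.
    by rewrite !mxE eqxx /=; ring.
  case: (eqVneq j i) => [->|ji]; first by rewrite ltnn add0r mulr1.
  by rewrite mulr0 addr0; case: ifP; rewrite // normr0.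
have step (i : 'I_n) : exists xi : 'rV[R]_n, (forall j, `|xi 0 j - x 0 j| <= `|v 0 j|) /\
    f (x + tr i.+1) - f (x + tr i) = v 0 i * partial i f xi.
  have [s sv|c cv E] := @mean_value0 R (fun s => f (w i s)) (fun s => partial i f (w i s)) (v 0 i).
    by apply: line_derive; apply: df; exact: wP.
  exists (w i c); split; first exact: wP.
  rewrite -E /w scale0r addr0; congr (f _ - _); rewrite -addrA; congr (_ + _).
  apply/rowP => j; rewrite !mxE eqxx /= ltnS leq_eqVlt -val_eqE /=.
  case: (eqVneq (j : nat) i) => [/val_inj ->|ji]; first by rewrite ltnn add0r mulr1.
  by rewrite mulr0 addr0.
have {step} [xi xiP] := choice step.
exists xi => [i|]; first by have [] := xiP i.
have trn : tr n = v by apply/rowP => j; rewrite mxE ltn_ord.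
have tr0 : tr 0%N = 0 by apply/rowP => j; rewrite !mxE.
rewrite -{1}trn -{2}[x]addr0 -tr0 -(telescope_sumr (fun k => f (x + tr k)))// big_mkord.
by apply: eq_bigr => i _; have [] := xiP i.
Qed.

(** The difference quotient is a sum of difference quotients of the coordinates
of c times partial derivatives at intermediate points ([increments]), which
tend to c t. *)
Lemma chain_rule f (c : R -> 'rV[R]_n) (c' : 'I_n -> R) t :
  (\forall z \near c t, forall i, derivable f z (e_ i)) ->
  (forall i, {for c t, continuous (partial i f)}) ->
  (forall i, is_derive t (1 : R) (fun s => c s 0 i) (c' i)) ->
  is_derive t (1 : R) (fun s => f (c s)) (\sum_(i < n) c' i * partial i f (c t)).
Proof.
move=> /nbhs_ballP[e /= e0 eP] fc cd.
pose good h := forall j, `|c (h + t) 0 j - c t 0 j| < e.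
have small (d : R) : 0 < d ->
    \forall h \near 0^', forall j, `|c (h + t) 0 j - c t 0 j| < d.
  move=> d0; apply: filter_forall => j.
  have /cvgrPdist_lt/(_ d d0) := derive_at_continuous (cd j).
  move=> /nbhs_ballP[r /= r0 rP]; exists r => //= h; rewrite /ball_ /= sub0r normrN => hr _.
  by rewrite distrC; apply: rP; rewrite -ball_normE /= opprD addrCA subrr addr0 normrN.
have xiP h : exists xi : 'I_n -> 'rV[R]_n,
    (forall i j, `|xi i 0 j - c t 0 j| <= `|c (h + t) 0 j - c t 0 j|) /\
    (good h -> f (c (h + t)) - f (c t) =
      \sum_(i < n) (c (h + t) 0 i - c t 0 i) * partial i f (xi i)).
  have [gh|ngh] := pselect (good h); last first.
    by exists (fun=> c t); split=> [i j|//]; rewrite subrr normr0.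
  have [z zP i|xi xi1 xi2] := @increments f (c t) (c (h + t) - c t).
    apply: eP; split=> // k j; rewrite ord1 -ball_normE /= distrC.
    by apply: le_lt_trans (zP j) _; rewrite !mxE; exact: gh.
  exists xi; split=> [i j|_]; first by have := xi1 i j; rewrite !mxE.
  by rewrite [c t + _]addrC subrK in xi2; rewrite xi2; apply: eq_bigr => i _; rewrite !mxE.
have [xi {}xiP] := choice xiP.
apply/is_derive_cvg.
have xic i : xi h i @[h --> 0^'] --> c t.
  move=> A /nbhs_ballP[d /= d0 dA]; rewrite /nbhs /=.
  apply: filterS (small d d0) => h hd; apply: dA; split=> // k j.
  by rewrite ord1 -ball_normE /= distrC (le_lt_trans _ (hd j))//; have [->] := xiP h.
have lim : \sum_(i < n) (h^-1 *: (c (h + t) 0 i - c t 0 i)) * partial i f (xi h i)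
    @[h --> 0^'] --> \sum_(i < n) c' i * partial i f (c t).
  apply: cvg_big => [|i _]; first exact: add_continuous.
  apply: cvgM; first by have /is_derive_cvg := cd i.
  exact: (continuous_cvg _ (fc i) (xic i)).
apply: cvg_trans lim; apply: near_eq_cvg.
apply: filterS (small e e0) => h gh; have [_ /(_ gh) ->] := xiP h.
by rewrite scaler_sumr; apply: eq_bigr => i _; rewrite scalerAl.
Qed.

(** The mean value theorem, first along the i-th and then along the j-th
coordinate, for the second difference of f over a square. *)
Lemma mixed_increment f x (i j : 'I_n) (h : R) : 0 < h ->
  (forall s u, 0 <= s <= h -> 0 <= u <= h -> derivable f (x + s *: e_ i + u *: e_ j) (e_ i)) ->
  (forall s u, 0 <= s <= h -> 0 <= u <= h ->
     derivable (partial i f) (x + s *: e_ i + u *: e_ j) (e_ j)) ->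
  exists s u, [/\ 0 <= s <= h, 0 <= u <= h &
    f (x + h *: e_ i + h *: e_ j) - f (x + h *: e_ i) - (f (x + h *: e_ j) - f x) =
    h ^+ 2 * partial j (partial i f) (x + s *: e_ i + u *: e_ j)].
Proof.
move=> h0 d1 d2; have hh : 0 <= h <= h by rewrite lexx ltW.
have h00 : 0 <= (0 : R) <= h by rewrite lexx ltW.
pose g s := f (x + s *: e_ i + h *: e_ j) - f (x + s *: e_ i + 0 *: e_ j).
pose dg s := partial i f (x + s *: e_ i + h *: e_ j) - partial i f (x + s *: e_ i + 0 *: e_ j).
have [s sh|s sh] := @mean_value R g dg 0 h (ltW h0).
  have line u : 0 <= u <= h -> is_derive s (1 : R)
      (fun s => f (x + s *: e_ i + u *: e_ j)) (partial i f (x + s *: e_ i + u *: e_ j)).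
    move=> uh; rewrite addrAC.
    have -> : (fun s : R => f (x + s *: e_ i + u *: e_ j)) =
        (fun s => f (x + u *: e_ j + s *: e_ i)).
      by apply/funext => y; rewrite addrAC.
    by apply: line_derive; rewrite addrAC; exact: d1.
  exact: is_deriveB (line h hh) (line 0 h00).
rewrite /g /dg !scale0r !addr0 subr0 => ->.
have [u uh|u uh E] := @mean_value R (fun u => partial i f (x + s *: e_ i + u *: e_ j))
   (fun u => partial j (partial i f) (x + s *: e_ i + u *: e_ j)) 0 h (ltW h0).
  by apply: line_derive; exact: d2.
exists s, u; split=> //; rewrite scale0r addr0 subr0 in E.
by rewrite E; ring.
Qed.


Let small_sum (S U h e : R) : 0 <= S <= h -> 0 <= U <= h -> h * 4 = e -> 0 < h ->
  - e < S + U < e.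
Proof. by move=> /andP[? ?] /andP[? ?] ? ?; apply/andP; split; lra. Qed.

Let scale_bool (s h : R) (p : bool) : 0 <= s <= h -> 0 <= s * p%:R <= h.
Proof. by case: p; rewrite ?mulr1// mulr0 lexx /= => /andP[/le_trans]; apply. Qed.

Let close (A B C eps : R) : `|A - C| < eps -> `|B - C| < eps ->
  `|A - B| = eps + eps -> False.
Proof.
by move=> AC BC AB; have := ler_distD C A B; rewrite AB [`|C - B|]distrC; lra.
Qed.

(** The second difference over a small square is symmetric in i and j; by
[mixed_increment] it gives a common value of both second derivatives at two
points near x, and both are continuous. *)
Lemma schwarz f x (i j : 'I_n) :
  (\forall z \near x, forall k, derivable f z (e_ k)) ->
  (\forall z \near x, forall k l, derivable (partial k f) z (e_ l)) ->
  (forall k l, {for x, continuous (partial l (partial k f))}) ->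
  partial j (partial i f) x = partial i (partial j f) x.
Proof.
move=> d1 d2 c2; apply: contrapT => /eqP ne.
pose eps := `|partial j (partial i f) x - partial i (partial j f) x| / 2.
have eps0 : 0 < eps by rewrite divr_gt0// normr_gt0 subr_eq0.
have /cvgrPdist_lt/(_ _ eps0) n1 := c2 i j.
have /cvgrPdist_lt/(_ _ eps0) n2 := c2 j i.
have /nbhs_ballP[e /= e0 eP] : \forall z \near x,
    ((forall k, derivable f z (e_ k)) /\
     (forall k l, derivable (partial k f) z (e_ l))) /\
    (`|partial j (partial i f) x - partial j (partial i f) z| < eps /\
     `|partial i (partial j f) x - partial i (partial j f) z| < eps).
  exact: (filterI (filterI d1 d2) (filterI n1 n2)).
(* the square of side h around x stays within distance 2h of x *)
pose h := e / 4; have h0 : 0 < h by rewrite divr_gt0.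
have inb (k l : 'I_n) (s u : R) : 0 <= s <= h -> 0 <= u <= h ->
    ball x e (x + s *: e_ k + u *: e_ l).
  move=> sh uh; split=> // a b; rewrite ord1 -ball_normE /= distrC ltr_norml.
  rewrite (_ : _ - x 0 b = s * (b == k)%:R + u * (b == l)%:R); last first.
    by rewrite !mxE eqxx /=; ring.
  apply: (@small_sum _ _ h); rewrite ?scale_bool//.
  by rewrite /h mulfVK.
have [||s [u [sh uh E]]] := @mixed_increment f x i j h h0.
- by move=> s u sh uh; have [[/(_ i)]] := eP _ (inb i j s u sh uh).
- by move=> s u sh uh; have [[_ /(_ i j)]] := eP _ (inb i j s u sh uh).
have [||s' [u' [sh' uh' E']]] := @mixed_increment f x j i h h0.
- by move=> s' u' sh' uh'; have [[/(_ j)]] := eP _ (inb j i s' u' sh' uh').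
- by move=> s' u' sh' uh'; have [[_ /(_ j i)]] := eP _ (inb j i s' u' sh' uh').
have h2 : h ^+ 2 != 0 by rewrite expf_neq0// gt_eqF.
have EE : partial j (partial i f) (x + s *: e_ i + u *: e_ j) =
    partial i (partial j f) (x + s' *: e_ j + u' *: e_ i).
  have swap (p p' q r t X Y : R) : p' = p -> p - q - (r - t) = X ->
      p' - r - (q - t) = Y -> X = Y by move=> -> <- <-; ring.
  apply: (mulfI h2).
  exact: swap (congr1 f (addrAC x (h *: e_ j) (h *: e_ i))) E E'.
have [_ [N1 _]] := eP _ (inb i j s u sh uh).
have [_ [_ N2]] := eP _ (inb j i s' u' sh' uh').
rewrite /= in N1 N2; rewrite EE in N1.
by apply: (close N1 N2); rewrite /eps -splitr.
Qed.

End several_variables.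

(** * Scalar products and separation *)

Section euclidean.
Context (R : realType) (n : nat).
Implicit Types (x y u v w d : 'rV[R]_n) (K L : set 'rV[R]_n).

Lemma dotC u v : dot u v = dot v u.
Proof. by apply: eq_bigr => i _; rewrite mulrC. Qed.

Lemma dotDl u v w : dot (u + v) w = dot u w + dot v w.
Proof. by rewrite -big_split; apply: eq_bigr => i _; rewrite mxE mulrDl. Qed.

Lemma dotZl (a : R) u w : dot (a *: u) w = a * dot u w.
Proof. by rewrite mulr_sumr; apply: eq_bigr => i _; rewrite mxE mulrA. Qed.

Lemma dotDr u v w : dot w (u + v) = dot w u + dot w v.
Proof. by rewrite !(dotC w) dotDl. Qed.

Lemma dotZr (a : R) u w : dot w (a *: u) = a * dot w u.
Proof. by rewrite !(dotC w) dotZl. Qed.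

Lemma dotNl u w : dot (- u) w = - dot u w.
Proof. by rewrite -scaleN1r dotZl mulN1r. Qed.

Lemma dotNr u w : dot w (- u) = - dot w u.
Proof. by rewrite !(dotC w) dotNl. Qed.

Lemma dot0l w : dot 0 w = 0. Proof. by rewrite -(scale0r w) dotZl mul0r. Qed.
Lemma dot0r w : dot w 0 = 0. Proof. by rewrite dotC dot0l. Qed.

Lemma dot_ge0 u : 0 <= dot u u.
Proof. by apply: sumr_ge0 => i _; rewrite -expr2 sqr_ge0. Qed.

Lemma dot_eq0 u : (dot u u == 0) = (u == 0).
Proof.
apply/idP/eqP => [|->]; last by rewrite dot0l.
rewrite /dot psumr_eq0; last by move=> i _; rewrite -expr2 sqr_ge0.
move=> /allP u0; apply/rowP => i; rewrite mxE; apply/eqP.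
by have := u0 i (mem_index_enum _); rewrite /= mulf_eq0 orbb.
Qed.

Lemma dot_gt0 u : u != 0 -> 0 < dot u u.
Proof. by move=> u0; rewrite lt_def dot_eq0 u0 dot_ge0. Qed.

Definition nrm u := Num.sqrt (dot u u).

Lemma nrm_ge0 u : 0 <= nrm u. Proof. exact: sqrtr_ge0. Qed.

Lemma nrm_sqr u : nrm u ^+ 2 = dot u u.
Proof. by rewrite sqr_sqrtr// dot_ge0. Qed.

Lemma nrm_gt0 u : u != 0 -> 0 < nrm u.
Proof. by move=> u0; rewrite sqrtr_gt0 dot_gt0. Qed.

Lemma nrmZ (a : R) u : 0 <= a -> nrm (a *: u) = a * nrm u.
Proof.
by move=> a0; rewrite /nrm dotZl dotZr mulrA -expr2 sqrtrM ?sqr_ge0// sqrtr_sqr ger0_norm.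
Qed.

Lemma nrm1 u : dot u u = 1 -> nrm u = 1.
Proof. by rewrite /nrm => ->; rewrite sqrtr1. Qed.

Lemma cauchy_schwarz u v : dot u v <= nrm u * nrm v.
Proof.
have [->|u0] := eqVneq u 0; first by rewrite dot0l mulr_ge0 ?nrm_ge0.
have [->|v0] := eqVneq v 0; first by rewrite dot0r mulr_ge0 ?nrm_ge0.
have := dot_ge0 (nrm v *: u - nrm u *: v).
rewrite dotDl !dotDr !dotNl !dotNr !dotZl !dotZr -!nrm_sqr (dotC v u).
have := nrm_gt0 u0; have := nrm_gt0 v0; set a := nrm u; set b := nrm v => b0 a0.
have ab : 0 < a * b by rewrite mulr_gt0.
by move=> h; rewrite -(ler_pM2l ab); lra.
Qed.

Lemma normalize u : u != 0 -> dot ((nrm u)^-1 *: u) ((nrm u)^-1 *: u) = 1.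
Proof.
move=> u0; have n0 := nrm_gt0 u0.
by rewrite dotZl dotZr -nrm_sqr; field; rewrite gt_eqF.
Qed.

Lemma coord_continuous_rV (i : 'I_n) : continuous (fun x => x 0 i).
Proof. exact: coord_continuous. Qed.

Lemma dot_continuous (f g : 'rV[R]_n -> 'rV[R]_n) : continuous f -> continuous g ->
  continuous (fun x => dot (f x) (g x)).
Proof.
move=> cf cg x; apply: (@cvg_big _ _ _ _ _ add_continuous _ (nbhs x)) => i _.
apply: cvgM.
  exact: (continuous_comp (cf x) (@coord_continuous_rV i _)).
exact: (continuous_comp (cg x) (@coord_continuous_rV i _)).
Qed.

Lemma dot_subZ u v (t : R) : dot (u - t *: v) (u - t *: v) =
  dot u u - 2 * t * dot u v + t ^+ 2 * dot v v.
Proof. by rewrite !dotDl !dotDr !dotNl !dotNr !dotZl !dotZr (dotC v u); ring. Qed.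

(** Let v0 be the point of C nearest to z. By convexity z - v0 has a
nonpositive product with every v - v0; choosing y = z - v0 forces z = v0. *)
Lemma separation (C : set 'rV[R]_n) z : compact C -> C !=set0 ->
  (forall x y (t : R), C x -> C y -> 0 <= t -> t <= 1 -> C (t *: x + (1 - t) *: y)) ->
  (forall y, exists2 v, C v & dot y z <= dot y v) -> C z.
Proof.
move=> cC C0 vC zC.
have [|v0 /[!inE] Cv0 vmin] := @EVT_min_rV R n (fun v => dot (z - v) (z - v)) C C0 cC.
  apply: continuous_subspaceT => x; apply: dot_continuous => y.
    by apply: continuousB; [exact: cst_continuous | exact: cvg_id].
  by apply: continuousB; [exact: cst_continuous | exact: cvg_id].
have [v Cv zv] := zC (z - v0).
suff /eqP : dot (z - v0) (z - v0) == 0 by move=> /eqP; rewrite dot_eq0 subr_eq0 => /eqP ->.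
have dotB p u w : dot p (u - w) = dot p u - dot p w by rewrite dotDr dotNr.
suff le0 : dot (z - v0) (v - v0) <= 0.
  by rewrite eq_le dot_ge0 andbT (le_trans _ le0)// !(dotB (z - v0)) lerD2r.
set b := dot (z - v0) (v - v0); set a := dot (v - v0) (v - v0).
have step (t : R) : 0 < t -> t <= 1 -> 2 * b <= t * a.
  move=> t0 t1; have := vmin (t *: v + (1 - t) *: v0).
  rewrite inE => /(_ (vC _ _ _ Cv Cv0 (ltW t0) t1)).
  have -> : z - (t *: v + (1 - t) *: v0) = (z - v0) - t *: (v - v0).
    by apply/rowP => i; rewrite !mxE; ring.
  by rewrite dot_subZ -/a -/b => h; rewrite -(ler_pM2l t0); lra.
rewrite leNgt; apply/negP => b0.
have a0 : 0 <= a by exact: dot_ge0.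
(* for a step this small, the quadratic term t a stays below b *)
have := step (Num.min 1 (b / (a + 1))).
rewrite lt_min ltr01 divr_gt0 ?ltr_wpDl// ge_min lexx => /(_ isT isT).
apply/negP; rewrite -ltNge; apply: (@le_lt_trans _ _ (b / (a + 1) * a)).
  by rewrite ler_wpM2r// ge_min lexx orbT.
rewrite mulrAC ltr_pdivrMr ?ltr_wpDl//; nra.
Qed.

End euclidean.

(** * Support functions *)

Section support.
Context (R : realType) (n : nat) (K : set 'rV[R]_n).
Hypothesis bK : convex_body K.
Implicit Types (x y u v w d : 'rV[R]_n).
Local Notation p := (support_function K).

Lemma convex_body_nonempty : K !=set0.
Proof.
have [x0 [r [r0 rK]]] := convex_body_box bK; exists x0; apply: rK => i.
by rewrite subrr normr0 ltW.
Qed.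

Lemma support_attained x : exists2 v, K v &
  p x = dot x v /\ forall u, K u -> dot x u <= dot x v.
Proof.
have cK := convex_body_compact bK.
have [|v /[!inE] Kv vmax] := @EVT_max_rV R n (fun v => dot x v) K convex_body_nonempty cK.
  apply: continuous_subspaceT; apply: dot_continuous => y; first exact: cst_continuous.
  exact: cvg_id.
have vm u : K u -> dot x u <= dot x v by move=> Ku; apply: vmax; rewrite inE.
exists v => //; split=> //; apply/eqP; rewrite eq_le; apply/andP; split.
  by apply: ge_sup; [exists (dot x v), v | move=> _ [u Ku <-]; exact: vm].
apply: ub_le_sup; last by exists v.
by exists (dot x v) => _ [u Ku <-]; exact: vm.
Qed.

Lemma support_ge x v : K v -> dot x v <= p x.
Proof. by have [w _ [-> wmax]] := support_attained x => /wmax. Qed.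

Lemma supportZ (l : R) x : 0 <= l -> p (l *: x) = l * p x.
Proof.
move=> l0; have [v Kv [vE vmax]] := support_attained x.
have [w Kw [wE wmax]] := support_attained (l *: x).
apply/eqP; rewrite eq_le; apply/andP; split.
  by rewrite wE dotZl ler_wpM2l// support_ge.
by rewrite vE -dotZl support_ge.
Qed.

Lemma support0 : p 0 = 0.
Proof. by rewrite -(scale0r 0) supportZ ?mul0r. Qed.

Lemma mem_support z : K z <-> forall y, dot y z <= p y.
Proof.
split=> [Kz y|zP]; first exact: support_ge.
apply: separation => //; first exact: convex_body_compact.
- exact: convex_body_nonempty.
- exact: convex_body_conv.
by move=> y; have [v Kv [vE _]] := support_attained y; exists v; rewrite -?vE.
Qed.

End support.

(** * Rayleigh quotients *)

Section quadratic_form.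
Context (R : realType) (n : nat).
Implicit Types (x y u v w d : 'rV[R]_n).

Lemma mul_dot (H : 'M[R]_n) u v :
  dot (u *m H) v = \sum_(i < n) \sum_(j < n) u 0 i * H i j * v 0 j.
Proof.
rewrite exchange_big; apply: eq_bigr => j _; rewrite mxE mulr_suml.
by apply: eq_bigr.
Qed.

Lemma mul_dotC (H : 'M[R]_n) u v : H^T = H -> dot (u *m H) v = dot (v *m H) u.
Proof.
move=> sH; rewrite !mul_dot exchange_big; apply: eq_bigr => i _; apply: eq_bigr => j _.
by rewrite -[in LHS]sH mxE; ring.
Qed.

Lemma mulmx_continuous (H : 'M[R]_n) : continuous (fun v : 'rV[R]_n => v *m H).
Proof.
have -> : (fun v : 'rV[R]_n => v *m H) = (fun v => \sum_(i < n) v 0 i *: row i H).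
  by apply/funext => v; rewrite mulmx_sum_row.
move=> x; apply: (@cvg_big _ _ _ _ _ add_continuous _ (nbhs x)) => i _.
by apply: cvgZr_tmp; exact: coord_continuous.
Qed.

Lemma orth_sphere_compact w : compact [set d : 'rV[R]_n | dot d d = 1 /\ dot d w = 0].
Proof.
apply: bounded_closed_compact.
  exists 1; split=> // M M1 d [d1 _].
  rewrite /= (le_trans _ (ltW M1))//.
  have -> : `|d| = mx_norm d by [].
  rewrite mx_normrE; apply/bigmax_leP; split=> // -[i j] _ /=; rewrite ord1.
  rewrite -(@ler_sqr _ _ 1) ?nnegrE// expr1n real_normK ?num_real// -d1 /dot (bigD1 j)//=.
  by rewrite expr2 lerDl sumr_ge0// => k _; rewrite -expr2 sqr_ge0.
have -> : [set d | dot d d = 1 /\ dot d w = 0] =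
    (fun d => dot d d) @^-1` [set 1] `&` (fun d => dot d w) @^-1` [set 0] by [].
apply: closedI; apply: preimage_closed; try exact: closed_eq.
  by move=> x _; apply: dot_continuous => y; exact: cvg_id.
by move=> x _; apply: dot_continuous => y; [exact: cvg_id | exact: cst_continuous].
Qed.

(** The quotient attains its minimum lam on the unit vectors orthogonal to w.
Since perturbing the minimizer e in an orthogonal direction cannot decrease it,
and since H kills w, e is an eigenvector for lam, so m <= lam. *)
Lemma rayleigh_min (H : 'M[R]_n) w (m : R) : H^T = H -> w *m H = 0 -> dot w w = 1 ->
  (forall rho v, v != 0 -> dot v w = 0 -> v *m H = rho *: v -> m <= rho) ->
  forall d, dot d w = 0 -> m * dot d d <= dot (d *m H) d.
Proof.
move=> sH wH w1 eig d dw; have [->|d0] := eqVneq d 0.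
  by rewrite mul0mx !dot0l mulr0.
pose A := [set d : 'rV[R]_n | dot d d = 1 /\ dot d w = 0].
have unitA u : u != 0 -> dot u w = 0 -> A ((nrm u)^-1 *: u).
  by move=> u0 uw; split; [exact: normalize | rewrite dotZl uw mulr0].
have [|||e /[!inE] -[e1 ew] emin] := @EVT_min_rV R n (fun d => dot (d *m H) d) A.
- by exists ((nrm d)^-1 *: d); exact: unitA.
- exact: orth_sphere_compact.
- apply: continuous_subspaceT; apply: dot_continuous => [|y]; last exact: cvg_id.
  exact: mulmx_continuous.
set lam := dot (e *m H) e in emin.
have lamP u : dot u w = 0 -> lam * dot u u <= dot (u *m H) u.
  move=> uw; have [->|u0] := eqVneq u 0; first by rewrite mul0mx !dot0l mulr0.
  have := emin _ (mem_set (unitA _ u0 uw)); rewrite -scalemxAl dotZl dotZr -nrm_sqr.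
  have := nrm_gt0 u0; set a := nrm u => a0 h.
  rewrite -(ler_pM2r (x := a^-1 ^+ 2)) ?exprn_gt0 ?invr_gt0//.
  by rewrite -mulrA -exprMn divff ?gt_eqF// expr1n mulr1 expr2 mulrC -mulrA.
have orth f : dot f w = 0 -> dot (e *m H) f = lam * dot e f.
  move=> fw; set b := dot (e *m H) f - lam * dot e f.
  set a := dot (f *m H) f - lam * dot f f.
  have ab t : 0 <= 2 * t * b + t ^+ 2 * a.
    have := lamP (e + t *: f); rewrite dotDl dotZl ew fw mulr0 addr0 => /(_ erefl).
    rewrite mulmxDl -scalemxAl !dotDl !dotDr !dotZl !dotZr e1 (mul_dotC f e sH) -/lam.
    rewrite (dotC f e) -subr_ge0 => h; apply: (le_trans h).
    by rewrite le_eqVlt /a /b; apply/orP; left; apply/eqP; ring.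
  apply/eqP; rewrite -subr_eq0 -/b; apply: contrapT => /negP b0.
  have a0 : 0 < `|a| + 1 by rewrite ltr_wpDl.
  (* for small t of the sign of - b, the linear term dominates *)
  have := ab (- b / (`|a| + 1)); apply/negP; rewrite -ltNge.
  have -> : 2 * (- b / (`|a| + 1)) * b + (- b / (`|a| + 1)) ^+ 2 * a =
      - (b / (`|a| + 1)) ^+ 2 * (2 * (`|a| + 1) - a) by field; rewrite gt_eqF.
  rewrite nmulr_rlt0 ?oppr_lt0; last first.
    by rewrite lt_def sqr_ge0 andbT expf_neq0// mulf_neq0// invr_eq0 gt_eqF.
  have := ler_norm a; have := normr_ge0 a; lra.
have eH : e *m H = lam *: e.
  apply/eqP; rewrite -subr_eq0 -dot_eq0; apply/eqP.
  set g := e *m H - lam *: e.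
  have gw : dot g w = 0.
    by rewrite /g dotDl dotNl dotZl ew mulr0 subr0 mul_dotC// wH dot0l.
  by rewrite {1}/g dotDl dotNl dotZl orth// subrr.
have e0 : e != 0 by rewrite -dot_eq0 e1 oner_eq0.
by rewrite (le_trans _ (lamP d dw))// ler_wpM2r ?dot_ge0// (eig lam e).
Qed.

End quadratic_form.

(** * The support function on great circles *)

Section curvature.
Context (R : realType) (n : nat) (K : set 'rV[R]_n).
Hypothesis K_C2 : C2_convex_body K.
Implicit Types (x y z u v w d : 'rV[R]_n).
Local Notation p := (support_function K).
Local Notation hess x := (hessian p x).

Let bK : convex_body K. Proof. by case: K_C2. Qed.

Definition grad x : 'rV[R]_n := \row_i partial i p x.

Lemma near_nonzero x : x != 0 -> \forall z \near x, z != 0.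
Proof.
move=> x0; have o : open [set z : 'rV[R]_n | z != 0].
  rewrite (_ : mkset _ = ~` [set 0]); last first.
    by apply/seteqP; split=> z /= /eqP.
  apply: closed_openC; apply: accessible_closed_set1.
  by apply: hausdorff_accessible; exact: norm_hausdorff.
exact: open_nbhs_nbhs.
Qed.

Lemma near_derivable x : x != 0 ->
  \forall z \near x, forall i, derivable p z (delta_mx 0 i).
Proof.
move=> /near_nonzero; apply: filterS => z z0 i.
by have [_ [/(_ i z z0)[]]] := K_C2.
Qed.

Lemma near_derivable2 x : x != 0 ->
  \forall z \near x, forall i j, derivable (partial i p) z (delta_mx 0 j).
Proof.
move=> /near_nonzero; apply: filterS => z z0 i j.
by have [_ [_ /(_ i j z z0)[]]] := K_C2.
Qed.

Lemma partial_continuous x i : x != 0 -> {for x, continuous (partial i p)}.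
Proof. by move=> x0; have [_ [/(_ i x x0)[]]] := K_C2. Qed.

Lemma partial2_continuous x i j : x != 0 ->
  {for x, continuous (partial j (partial i p))}.
Proof. by move=> x0; have [_ [_ /(_ i j x x0)[]]] := K_C2. Qed.

Lemma hess_sym x : x != 0 -> (hess x)^T = hess x.
Proof.
move=> x0; apply/matrixP => i j; rewrite !mxE; apply: schwarz.
- exact: near_derivable.
- exact: near_derivable2.
by move=> k l; exact: partial2_continuous.
Qed.

Lemma support_chain (c : R -> 'rV[R]_n) (c' : 'rV[R]_n) t : c t != 0 ->
  (forall i, is_derive t (1 : R) (fun s => c s 0 i) (c' 0 i)) ->
  is_derive t (1 : R) (fun s => p (c s)) (dot c' (grad (c t))).
Proof.
move=> c0 dc.
have := @chain_rule R n p c (fun i => c' 0 i) t (near_derivable c0) _ dc.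
rewrite (_ : dot _ _ = \sum_(i < n) c' 0 i * partial i p (c t)).
  by apply=> i; exact: partial_continuous.
by apply: eq_bigr => i _; rewrite mxE.
Qed.

Lemma partial_chain (c : R -> 'rV[R]_n) (c' : 'rV[R]_n) t i : c t != 0 ->
  (forall i, is_derive t (1 : R) (fun s => c s 0 i) (c' 0 i)) ->
  is_derive t (1 : R) (fun s => partial i p (c s)) ((c' *m hess (c t)) 0 i).
Proof.
move=> c0 dc.
have := @chain_rule R n (partial i p) c (fun i => c' 0 i) t _ _ dc.
rewrite (_ : (c' *m _) 0 i = \sum_(j < n) c' 0 j * partial j (partial i p) (c t)).
  apply=> [|j]; last exact: partial2_continuous.
  by apply: filterS (near_derivable2 c0) => z /(_ i).
rewrite mxE; apply: eq_bigr => j _; congr (_ * _).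
by rewrite -[in LHS](hess_sym c0) !mxE.
Qed.

Lemma dexpR (a : R) : is_derive (0 : R) (1 : R) (fun s => expR s * a) a.
Proof.
have -> : (fun s : R => expR s * a) = a \*: (@expR R).
  by apply/funext => s; rewrite /= mulrC.
by apply: is_derive_eq; rewrite expR0; exact: mulr1.
Qed.

Lemma dexp_curve x i : is_derive (0 : R) (1 : R) (fun s => (expR s *: x) 0 i) (x 0 i).
Proof.
have -> : (fun s : R => (expR s *: x) 0 i) = (fun s => expR s * x 0 i).
  by apply/funext => s; rewrite mxE.
exact: dexpR.
Qed.

(** Derivative of the identity p (exp t x) = exp t p x at t = 0; the
exponential keeps the identity valid for all t. *)
Lemma euler x : x != 0 -> dot x (grad x) = p x.
Proof.
move=> x0; have c0 : expR 0 *: x != 0 by rewrite expR0 scale1r.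
have := support_chain c0 (dexp_curve x); rewrite expR0 scale1r => d1.
apply: derive_uniq d1 _.
have -> : (fun s : R => p (expR s *: x)) = (fun s => expR s * p x).
  by apply/funext => s; rewrite supportZ// expR_ge0.
exact: dexpR.
Qed.

Lemma partialZ (l : R) x i : 0 < l -> x != 0 -> partial i p (l *: x) = partial i p x.
Proof.
move=> l0 x0; have lx0 : l *: x != 0 by rewrite scaler_eq0 gt_eqF.
pose c (s : R) : 'rV[R]_n := x + (s / l) *: delta_mx 0 i.
have dc j : is_derive (0 : R) (1 : R) (fun s => c s 0 j) ((l^-1 *: delta_mx 0 i : 'rV[R]_n) 0 j).
  have -> : (fun s : R => c s 0 j) =
      cst (x 0 j) + ((l^-1 * (j == i)%:R) \*: (@id R)).
    by apply/funext => s; rewrite /c !mxE eqxx /= !fctE /=; rewrite /GRing.scale /=; ring.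
  by apply: is_derive_eq; rewrite !mxE eqxx add0r; exact: mulr1.
have cE : c 0 = x by rewrite /c mul0r scale0r addr0.
have c0 : c 0 != 0 by rewrite cE.
have := support_chain c0 dc; rewrite cE => d1.
have d2 : is_derive (0 : R) (1 : R) (fun s => p (l *: x + s *: delta_mx 0 i)) (partial i p (l *: x)).
  have -> : partial i p (l *: x) = partial i p (l *: x + 0 *: delta_mx 0 i).
    by rewrite scale0r addr0.
  apply: line_derive; rewrite scale0r addr0.
  by have /nbhs_singleton := near_derivable lx0.
have d3 : is_derive (0 : R) (1 : R) (fun s => p (l *: x + s *: delta_mx 0 i))
    (l *: dot (l^-1 *: delta_mx 0 i) (grad x)).
  have -> : (fun s : R => p (l *: x + s *: delta_mx 0 i)) = l \*: (fun s => p (c s)).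
    apply/funext => s /=; rewrite -[RHS]/(l * p (c s)) -supportZ ?(ltW l0)//.
    by rewrite /c scalerDr scalerA mulrCA divff ?mulr1// gt_eqF.
  exact: is_deriveZ.
rewrite (derive_uniq d2 d3) -[LHS]/(l * _) dotZl mulrA divff ?mul1r ?gt_eqF//.
rewrite /dot (bigD1 i)//= big1 ?addr0 => [|j ji]; first by rewrite !mxE !eqxx mul1r.
by rewrite !mxE (negbTE ji) andbF mul0r.
Qed.

(** The partial derivatives are constant on the ray through x. *)
Lemma hess_ker x : x != 0 -> x *m hess x = 0.
Proof.
move=> x0; apply/rowP => i; rewrite [RHS]mxE.
have c0 : expR 0 *: x != 0 by rewrite expR0 scale1r.
have := partial_chain i c0 (dexp_curve x); rewrite expR0 scale1r => d1.
apply: derive_uniq d1 _.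
have -> : (fun s : R => partial i p (expR s *: x)) = cst (partial i p x).
  by apply/funext => s; rewrite partialZ// expR_gt0.
exact: is_derive_cst.
Qed.

Section circle.
Variables (sg tau : R).
Hypothesis curv : forall c d, dot c c = 1 -> dot d d = 1 -> dot d c = 0 ->
  0 <= sg * dot (d *m hess c) d + tau.

Lemma unit_nonzero x : dot x x = 1 -> x != 0.
Proof. by move=> x1; rewrite -dot_eq0 x1 oner_eq0. Qed.

Lemma dcos_sin (a b s : R) :
  is_derive s (1 : R) (fun s => cos s * a + sin s * b) (- sin s * a + cos s * b).
Proof.
have -> : (fun s : R => cos s * a + sin s * b) = a \*: (@cos R) + b \*: (@sin R).
  by apply/funext => u; rewrite fctE /= mulrC [sin u * b]mulrC.
by apply: is_derive_eq; rewrite /GRing.scale /=; ring.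
Qed.

Let product_rule (a b c d e : R) :
  a *: - b + c *: d + (e *: c + b *: a) = (d + e) * c.
Proof. by rewrite /GRing.scale /=; ring. Qed.

(** Let h(s) = sg p (c s) + tau along the circle c through x and z. As c'' = -
c and by Euler's identity, h'' + h is the curvature bounded in the hypothesis.
Hence W(s) = h'(s) sin (th - s) + h(s) cos (th - s) has derivative (h'' + h)
sin (th - s) >= 0 on [0, th]; the claim is W(0) <= W(th). *)
Lemma circle_ineq x z th : dot x x = 1 -> dot z z = 1 -> dot x z = 0 ->
  0 <= th <= pi ->
  dot (sg *: grad x + tau *: x) (cos th *: x + sin th *: z) <=
  sg * p (cos th *: x + sin th *: z) + tau.
Proof.
move=> x1 z1 xz /andP[th0 thpi].
pose c (s : R) := cos s *: x + sin s *: z.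
pose c1 (s : R) := - sin s *: x + cos s *: z.
have dc s i : is_derive s (1 : R) (fun s => c s 0 i) (c1 s 0 i).
  have -> : (fun s => c s 0 i) = (fun s => cos s * x 0 i + sin s * z 0 i).
    by apply/funext => u; rewrite !mxE.
  by rewrite !mxE; exact: dcos_sin.
have dc1 s i : is_derive s (1 : R) (fun s => c1 s 0 i) (- c s 0 i).
  have -> : (fun s => c1 s 0 i) = (fun s => cos s * z 0 i + sin s * (- x 0 i)).
    by apply/funext => u; rewrite !mxE; ring.
  apply: (is_derive_eq (dcos_sin _ _ _)); rewrite !mxE; ring.
have cc s : dot (c s) (c s) = 1.
  rewrite /c !dotDl !dotDr !dotZl !dotZr (dotC z x) xz x1 z1 -[RHS](cos2Dsin2 s); ring.
have c1c1 s : dot (c1 s) (c1 s) = 1.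
  rewrite /c1 !dotDl !dotDr !dotZl !dotZr (dotC z x) xz x1 z1 -[RHS](cos2Dsin2 s); ring.
have c1c s : dot (c1 s) (c s) = 0.
  rewrite /c1 /c !dotDl !dotDr !dotZl !dotZr (dotC z x) xz x1 z1; ring.
have c0 s : c s != 0 by exact: unit_nonzero.
pose h s := sg * p (c s) + tau.
pose h1 s := sg * dot (c1 s) (grad (c s)).
pose h2 s := sg * (dot (c1 s *m hess (c s)) (c1 s) - p (c s)).
have dh s : is_derive s (1 : R) h (h1 s).
  have dp := support_chain (c0 s) (dc s).
  have -> : h = (sg \*: (fun s => p (c s))) + cst tau by apply/funext.
  by apply: is_derive_eq; rewrite addr0.
have dh1 s : is_derive s (1 : R) h1 (h2 s).
  have -> : h1 = sg \*: (\sum_(i < n) ((fun s => c1 s 0 i) * (fun s => partial i p (c s)))).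
    apply/funext => u; rewrite /h1 /= fct_sumE; congr (_ * _).
    by apply: eq_bigr => i _; congr (_ * _); rewrite mxE.
  have dp i := partial_chain i (c0 s) (dc s).
  apply: is_derive_eq; rewrite /h2 -[LHS]/(sg * _); congr (_ * _).
  rewrite -(euler (c0 s)) [X in X - _]dotC /dot -sumrB; apply: eq_bigr => i _.
  rewrite [grad _ _ _]mxE -![_ *: _]/(_ * _); ring.
(* S s = sin (th - s) and C s = cos (th - s), expanded *)
pose S s := cos s * sin th + sin s * (- cos th).
pose C s := cos s * cos th + sin s * sin th.
have dS s : is_derive s (1 : R) S (- C s).
  by apply: (is_derive_eq (dcos_sin _ _ _)); rewrite /C; ring.
have dC s : is_derive s (1 : R) C (S s).
  by apply: (is_derive_eq (dcos_sin _ _ _)); rewrite /S; ring.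
pose W s := h1 s * S s + h s * C s.
have dW s : is_derive s (1 : R) W ((h2 s + h s) * S s).
  have -> : W = h1 * S + h * C by apply/funext.
  by apply: is_derive_eq; exact: product_rule.
have W0 : W 0 = dot (sg *: grad x + tau *: x) (cos th *: x + sin th *: z).
  rewrite /W /h1 /h /S /C /c1 /c cos0 sin0 !mul0r !addr0 !mul1r oppr0 !scale0r.
  rewrite !scale1r addr0 add0r -(euler (unit_nonzero x1)).
  rewrite !dotDl !dotDr !dotZl !dotZr x1 xz (dotC (grad x) x) (dotC (grad x) z); ring.
have Wth : W th = sg * p (cos th *: x + sin th *: z) + tau.
  rewrite /W /S /C (_ : _ + _ * - _ = 0) ?mulr0 ?add0r; last by ring.
  by rewrite -!expr2 cos2Dsin2 mulr1.
rewrite -W0 -Wth; apply: (derive_ge0_le th0 (fun s _ => dW s)) => s /andP[s0 sth].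
apply: mulr_ge0.
  rewrite /h2 /h (_ : _ + _ = sg * dot (c1 s *m hess (c s)) (c1 s) + tau); last by ring.
  exact: curv.
have -> : S s = sin (th - s) by rewrite sinB /S; ring.
by apply: sin_ge0_pi; rewrite subr_ge0 sth lerBlDr (le_trans thpi)// lerDl.
Qed.

End circle.
End curvature.

(** * Convex bodies from support functions *)

Section support_calculus.
Context (R : realType) (n : nat).
Implicit Types (x y z u v w d : 'rV[R]_n) (A B K L : set 'rV[R]_n).

(** Convex bodies are equal as soon as their support functions are, so
identities between Minkowski combinations become identities between functions.
*)
Lemma support_inj A B : convex_body A -> convex_body B ->
  (forall y, support_function A y = support_function B y) -> A = B.
Proof.
move=> bA bB AB; apply/seteqP; split=> z zP.
  by apply: (mem_support bB z).2 => y; rewrite -AB support_ge.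
by apply: (mem_support bA z).2 => y; rewrite AB support_ge.
Qed.

Lemma support_unique K x v : convex_body K -> K v ->
  (forall u, K u -> dot x u <= dot x v) -> support_function K x = dot x v.
Proof.
move=> bK Kv vmax; have [w Kw [-> wmax]] := support_attained bK x.
by apply/eqP; rewrite eq_le vmax ?wmax.
Qed.

Lemma support_mink (a b : R) K L y : 0 <= a -> 0 <= b -> 0 < a + b ->
  convex_body K -> convex_body L ->
  support_function (mink a K b L) y =
  a * support_function K y + b * support_function L y.
Proof.
move=> a0 b0 ab bK bL.
have [u Ku [-> umax]] := support_attained bK y.
have [v Lv [-> vmax]] := support_attained bL y.
rewrite (@support_unique _ _ (a *: u + b *: v)).
- by rewrite dotDr !dotZr.
- exact: mink_convex_body.
- by exists u => //; exists v.
move=> _ [u' Ku' [v' Lv' <-]]; rewrite !dotDr !dotZr.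
by apply: lerD; apply: ler_wpM2l => //; [exact: umax | exact: vmax].
Qed.

Lemma halfspaces_closed (q : 'rV[R]_n -> R) :
  closed [set v | forall y, dot y v <= q y].
Proof.
have -> : [set v | forall y, dot y v <= q y] =
    \bigcap_(y in [set: 'rV[R]_n]) ((dot y) @^-1` [set t | t <= q y]).
  by apply/seteqP; split=> [v vq y _|v vq y]; exact: vq.
apply: closed_bigI => y _; apply: preimage_closed; last exact: closed_le.
by move=> x _; apply: dot_continuous => u; [exact: cst_continuous | exact: cvg_id].
Qed.

Lemma bounded_by_set A c : bounded_by A c -> bounded_set A.
Proof.
move=> Ac; exists (Num.max c 0); split; first exact: num_real.
move=> M; rewrite gt_max => /andP[cM M0] x Ax /=.
have -> : `|x| = mx_norm x by [].
rewrite mx_normrE; apply/bigmax_leP; split; first exact: ltW.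
by move=> -[i j] _ /=; rewrite ord1 (le_trans (Ac x Ax j))// ltW.
Qed.

Lemma dot_delta i v : dot (delta_mx 0 i) v = v 0 i.
Proof.
rewrite /dot (bigD1 i)//= big1 ?addr0 => [|j ji]; first by rewrite mxE !eqxx mul1r.
by rewrite mxE (negbTE ji) andbF mul0r.
Qed.

Lemma halfspaces_compact (q : 'rV[R]_n -> R) :
  compact [set v | forall y, dot y v <= q y].
Proof.
apply: bounded_closed_compact; last exact: halfspaces_closed.
apply: (@bounded_by_set _ (\sum_(i < n) (`|q (delta_mx 0 i)| + `|q (- delta_mx 0 i)|))).
move=> v vq i; rewrite (bigD1 i)//= -[leLHS]addr0; apply: lerD; last first.
  by apply: sumr_ge0 => j _; rewrite addr_ge0.
rewrite ler_norml; apply/andP; split.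
  have := vq (- delta_mx 0 i); rewrite dotNl dot_delta => h.
  have := ler_norm (q (- delta_mx 0 i)); have := normr_ge0 (q (delta_mx 0 i)); lra.
have := vq (delta_mx 0 i); rewrite dot_delta => h.
have := ler_norm (q (delta_mx 0 i)); have := normr_ge0 (q (- delta_mx 0 i)); lra.
Qed.

(** Turn x by a right angle inside the plane of the coordinates i and j, where
x_i is nonzero. *)
Lemma exists_orth x : (2 <= n)%N -> dot x x = 1 ->
  exists2 z, dot z z = 1 & dot x z = 0.
Proof.
move=> n2 x1; suff [u u0 xu] : exists2 u, u != 0 & dot x u = 0.
  by exists ((nrm u)^-1 *: u); [exact: normalize | rewrite dotZr xu mulr0].
have x0 : x != 0 by rewrite -dot_eq0 x1 oner_eq0.
have [i xi] : exists i, x 0 i != 0.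
  apply: contrapT => nx; move/eqP: x0; apply; apply/rowP => i; rewrite mxE.
  by apply: contrapT => /eqP xi; apply: nx; exists i.
have [j ji] : exists j : 'I_n, j != i.
  have [n0 n1] : (0 < n)%N /\ (1 < n)%N by split=> //; exact: ltnW.
  case: (eqVneq i (Ordinal n0)) => [->|]; last by exists (Ordinal n0); rewrite eq_sym.
  by exists (Ordinal n1).
exists (x 0 j *: delta_mx 0 i - x 0 i *: delta_mx 0 j); last first.
  by rewrite dotC dotDl dotNl !dotZl !dot_delta; ring.
apply/eqP => /rowP/(_ j); rewrite !mxE !eqxx (negbTE ji) /=.
by move/eqP; rewrite mulr0 add0r mulr1 oppr_eq0 (negbTE xi).
Qed.

End support_calculus.

Section wulff.
Context (R : realType) (n : nat) (n_ge2 : (2 <= n)%N) (K : set 'rV[R]_n).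
Hypothesis K_C2 : C2_convex_body K.
Implicit Types (x y z u v w d : 'rV[R]_n).
Local Notation p := (support_function K).

Let bK : convex_body K. Proof. by case: K_C2. Qed.

Definition combined_support (sg tau : R) y := sg * p y + tau * nrm y.

(** Wulff shape: the largest convex set whose support function is at most sg p
+ tau |.|. The bodies L and M above are the cases (1, - s) and (-1, t). *)
Definition wulff (sg tau : R) : set 'rV[R]_n :=
  [set v | forall y, dot y v <= combined_support sg tau y].

Definition curvature_ge (sg tau e : R) := forall c d,
  dot c c = 1 -> dot d d = 1 -> dot d c = 0 ->
  e <= sg * dot (d *m hessian p c) d + tau.

Lemma combined_supportZ sg tau (l : R) y : 0 <= l ->
  combined_support sg tau (l *: y) = l * combined_support sg tau y.
Proof. by move=> l0; rewrite /combined_support supportZ// nrmZ//; ring. Qed.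

Lemma combined_support0 sg tau : combined_support sg tau 0 = 0.
Proof. by rewrite /combined_support support0// /nrm dot0l sqrtr0 !mulr0 addr0. Qed.

(** Every unit y lies on a great circle through x, at distance acos (x . y);
apply [circle_ineq]. *)
Lemma wulff_grad sg tau x : curvature_ge sg tau 0 -> dot x x = 1 ->
  wulff sg tau (sg *: grad K x + tau *: x) /\
  dot x (sg *: grad K x + tau *: x) = combined_support sg tau x.
Proof.
move=> curv x1; set g := _ + _.
have [z0 z01 xz0] := exists_orth n_ge2 x1.
split; last first.
  rewrite /g dotDr !dotZr x1 (euler K_C2) /combined_support ?nrm1//.
  exact: unit_nonzero.
move=> y; have [->|y0] := eqVneq y 0.
  by rewrite dot0l combined_support0.
pose y1 := (nrm y)^-1 *: y.
have ny := nrm_gt0 y0.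
have -> : y = nrm y *: y1 by rewrite scalerA divff ?scale1r// gt_eqF.
rewrite combined_supportZ ?(ltW ny)// dotZl ler_pM2l//.
have y11 : dot y1 y1 = 1 by exact: normalize.
pose a := dot x y1.
have a1 : -1 <= a <= 1.
  have := cauchy_schwarz x y1; have := cauchy_schwarz (- x) y1.
  have nx : nrm (- x) = 1 by rewrite nrm1// dotNl dotNr opprK.
  by rewrite dotNl nx !nrm1// mulr1 -/a => ? ?; apply/andP; split; lra.
have b2 : dot (y1 - a *: x) (y1 - a *: x) = 1 - a ^+ 2.
  by rewrite dot_subZ y11 x1 (dotC y1 x) -/a; ring.
pose b := Num.sqrt (1 - a ^+ 2).
have [z z1 [xz yE]] : exists2 z, dot z z = 1 & dot x z = 0 /\ y1 = a *: x + b *: z.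
  have [yx|yx] := eqVneq (y1 - a *: x) 0.
    exists z0 => //; split=> //; have : 1 - a ^+ 2 = 0 by rewrite -b2 yx dot0l.
    rewrite /b => ->; rewrite sqrtr0 scale0r addr0.
    by apply/eqP; rewrite -subr_eq0 yx.
  have bE : nrm (y1 - a *: x) = b by rewrite /nrm b2.
  have b0 : b != 0 by rewrite -bE gt_eqF// nrm_gt0.
  exists (b^-1 *: (y1 - a *: x)); first by rewrite -bE; exact: normalize.
  split; first by rewrite dotZr dotDr dotNr dotZr x1 -/a mulr1 subrr mulr0.
  by rewrite scalerA divff// scale1r addrC subrK.
have th : 0 <= acos a <= pi by rewrite acos_ge0 ?acos_lepi.
have := circle_ineq K_C2 curv x1 z1 xz th.
rewrite acosK ?in_itv//= sin_acos// -/b -yE dotC /combined_support.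
by rewrite [nrm y1]nrm1// mulr1.
Qed.

Lemma wulff_nonempty sg tau : curvature_ge sg tau 0 -> wulff sg tau !=set0.
Proof.
move=> curv.
have e1 : dot (delta_mx 0 (Ordinal (ltnW n_ge2)) : 'rV[R]_n) (delta_mx 0 (Ordinal (ltnW n_ge2))) = 1.
  by rewrite dot_delta mxE !eqxx.
by eexists; exact: (wulff_grad curv e1).1.
Qed.

(** Reserving the part e |.| of the support function leaves room for a ball of
radius e. *)
Lemma wulff_add sg tau e v u : 0 <= e -> wulff sg (tau - e) v -> dot u u <= 1 ->
  wulff sg tau (v + e *: u).
Proof.
move=> e0 Lv u1 y; rewrite dotDr dotZr.
have yu : dot y u <= nrm y.
  rewrite (le_trans (cauchy_schwarz y u))// ler_piMr ?nrm_ge0//.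
  by rewrite -sqrtr1 ler_wsqrtr.
have := Lv y; rewrite /combined_support => h.
have := ler_wpM2l e0 yu; lra.
Qed.

(** The margin e in the curvature provides an interior point, by [wulff_add].
*)
Lemma wulff_convex_body sg tau e : 0 < e -> curvature_ge sg tau e ->
  convex_body (wulff sg tau).
Proof.
move=> e0 curv; have curv0 : curvature_ge sg (tau - e) 0.
  by move=> c d c1 d1 dc; have := curv c d c1 d1 dc; lra.
have [v0 Lv0] := wulff_nonempty curv0.
have nR : 0 < n%:R :> R by rewrite ltr0n ltnW.
apply: (@convex_bodyI _ _ _ v0 (e / n%:R)).
- exact: halfspaces_compact.
- move=> x y t Lx Ly t0 t1 w; rewrite dotDr !dotZr.
  have := ler_wpM2l t0 (Lx w); have t1' : 0 <= 1 - t by rewrite subr_ge0.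
  have := ler_wpM2l t1' (Ly w); lra.
- by rewrite divr_gt0.
move=> x xv.
have -> : x = v0 + e *: (e^-1 *: (x - v0)).
  by rewrite scalerA divff ?gt_eqF// scale1r addrC subrK.
apply: wulff_add => //; first exact: ltW.
rewrite /dot (@le_trans _ _ (\sum_(i < n) n%:R^-1))//; last first.
  by rewrite sumr_const card_ord -[_ *+ n]mulr_natl divff// gt_eqF.
apply: ler_sum => i _; rewrite !mxE -expr2 -real_normK ?num_real//.
have h : `|e^-1 * (x 0 i - v0 0 i)| <= n%:R^-1.
  rewrite normrM gtr0_norm ?invr_gt0// mulrC ler_pdivrMr// mulrC; exact: xv.
have n1 : n%:R^-1 <= 1 :> R by rewrite invf_le1// ler1n ltnW.
rewrite expr2 (le_trans (ler_wpM2l _ h))// ler_piMl//.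
by rewrite (le_trans h).
Qed.

(** The bound is attained at the gradient given by [wulff_grad]. *)
Lemma support_wulff sg tau e y : 0 < e -> curvature_ge sg tau e ->
  support_function (wulff sg tau) y = combined_support sg tau y.
Proof.
move=> e0 curv; have bL := wulff_convex_body e0 curv.
have curv0 : curvature_ge sg tau 0.
  by move=> c d c1 d1 dc; rewrite (le_trans (ltW e0))// curv.
have [->|y0] := eqVneq y 0.
  by rewrite support0// combined_support0.
have [Lg gE] := wulff_grad curv0 (normalize y0).
have ny := nrm_gt0 y0; set y1 := _ *: y in Lg gE.
have -> : y = nrm y *: y1 by rewrite scalerA divff ?scale1r// gt_eqF.
rewrite (@supportZ _ _ _ bL _ y1 (ltW ny)) (@combined_supportZ _ _ _ y1 (ltW ny)) -gE.
rewrite (support_unique bL Lg)// => u Lu.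
by rewrite gE; exact: Lu.
Qed.

(** The unit ball is the case sg = 0, tau = 1. *)
Lemma unit_ball_wulff : @unit_ball R n = wulff 0 1.
Proof.
apply/seteqP; split=> v.
  move=> v1; rewrite -[v]scale1r -[1 *: v]add0r; apply: wulff_add => // y.
  by rewrite dot0r /combined_support subrr !mul0r addr0.
move=> /(_ v); rewrite /combined_support mul0r add0r mul1r -nrm_sqr => h.
rewrite /unit_ball /= -nrm_sqr expr_le1 ?nrm_ge0//.
have [->|v0] := eqVneq v 0; first by rewrite /nrm dot0l sqrtr0.
by rewrite -(ler_pM2l (nrm_gt0 v0)) mulr1 -expr2.
Qed.

Lemma ball_curvature : curvature_ge 0 1 1.
Proof. by move=> c d _ _ _; rewrite mul0r add0r. Qed.

Lemma unit_ball_convex_body : convex_body (@unit_ball R n).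
Proof. by rewrite unit_ball_wulff; exact: wulff_convex_body ltr01 ball_curvature. Qed.

Lemma support_ball y : support_function (@unit_ball R n) y = nrm y.
Proof.
rewrite unit_ball_wulff (support_wulff _ ltr01 ball_curvature).
by rewrite /combined_support mul0r add0r mul1r.
Qed.

Section radii.
Variables (rho_min rho_max : R).
Hypothesis rho_minP : lbound (principal_radii K) rho_min.
Hypothesis rho_maxP : ubound (principal_radii K) rho_max.

Lemma curvature_min s : curvature_ge 1 (- s) (rho_min - s).
Proof.
move=> c d c1 d1 dc; have c0 := unit_nonzero c1.
have := rayleigh_min (hess_sym K_C2 c0) (hess_ker K_C2 c0) c1 _ dc (m := rho_min).
rewrite d1 mulr1 mul1r lerD2r; apply => rho v v0 vc vE.
by apply: rho_minP; exists c => //; exists v.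
Qed.

Lemma curvature_max s : curvature_ge (-1) s (s - rho_max).
Proof.
move=> c d c1 d1 dc; have c0 := unit_nonzero c1.
have symN : (- hessian p c)^T = - hessian p c by rewrite linearN /= hess_sym.
have kerN : c *m - hessian p c = 0 by rewrite mulmxN (hess_ker K_C2 c0) oppr0.
have := rayleigh_min symN kerN c1 _ dc (m := - rho_max).
rewrite d1 mulr1 mulN1r mulmxN dotNl => h; rewrite addrC lerD2r; apply: h.
move=> rho v v0 vc; rewrite mulmxN => vE.
rewrite lerNl; apply: rho_maxP; exists c => //; exists v; split=> //.
by rewrite scaleNr -vE opprK.
Qed.

(** Otherwise - p would also be at least a linear function, so that K would
have width 0 in some direction. *)
Lemma rho_max_ge0 : 0 <= rho_max.
Proof.
rewrite leNgt; apply/negP => neg.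
have curv : curvature_ge (-1) 0 0.
  by move=> c d c1 d1 dc; have := curvature_max 0 c1 d1 dc; lra.
have [v Lv] := wulff_nonempty curv.
have [x0 [r [r0 rK]]] := convex_body_box bK.
pose y : 'rV[R]_n := delta_mx 0 (Ordinal (ltnW n_ge2)).
have yy : dot y y = 1 by rewrite dot_delta mxE !eqxx.
have inK (s : R) : `|s| <= r -> K (x0 + s *: y).
  move=> sr; apply: rK => i; rewrite !mxE [x0 0 i + _]addrC addrK normrM.
  by rewrite -[leRHS]mulr1 ler_pM// normr_nat; case: (_ && _).
have K1 : K (x0 + r *: y) by apply: inK; rewrite gtr0_norm.
have K2 : K (x0 + (- r) *: y) by apply: inK; rewrite normrN gtr0_norm.
have := support_ge bK y K1; have := support_ge bK (- y) K2.
have := Lv y; have := Lv (- y).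
rewrite /combined_support !dotNl !dotDr !dotZr yy; lra.
Qed.

End radii.
End wulff.

(** * Steiner polynomials of the inner and outer bodies *)

Section steiner.
Context (R : realType) (n : nat) (n_ge2 : (2 <= n)%N) (K : set 'rV[R]_n).
Hypothesis K_C2 : C2_convex_body K.
Local Notation p := (support_function K).
Local Notation B := (@unit_ball R n).

Let bK : convex_body K. Proof. by case: K_C2. Qed.
Let bB : convex_body B. Proof. exact: unit_ball_convex_body K_C2. Qed.

Lemma parallel_body_mink (L : set 'rV[R]_n) t : parallel_body L t = mink 1 L t B.
Proof.
apply/seteqP; split=> [_ [v Lv [u Bu <-]]|_ [v Lv [u Bu <-]]];
  by exists v => //; exists u => //; rewrite scale1r.
Qed.

Lemma vol_parallel (L : set 'rV[R]_n) t : convex_body L -> 0 <= t ->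
  vol (parallel_body L t) = (volR (mink 1 L t B))%:E.
Proof.
move=> bL t0; rewrite parallel_body_mink volR_E//.
by apply: mink_convex_body; rewrite ?ler01 ?ltr_wpDr.
Qed.

Lemma poly_eq_nonneg (f g : {poly R}) : (forall t, 0 <= t -> f.[t] = g.[t]) -> f = g.
Proof.
move=> fg; apply/eqP; rewrite -subr_eq0; apply: contrapT => /negP fg0.
have := max_poly_roots (rs := [seq i%:R | i <- iota 0 (size (f - g))]) fg0.
rewrite size_map size_iota ltnn => h; apply: notF; apply: h.
  by apply/allP => _ /mapP[i _ ->]; rewrite /root !hornerE fg// subrr.
by rewrite map_inj_uniq ?iota_uniq// => i j /eqP; rewrite eqr_nat => /eqP.
Qed.

Section lower.
Variables (s e : R) (S : {poly R}).
Hypotheses (s0 : 0 <= s) (e0 : 0 < e) (curv : curvature_ge K 1 (- s) e).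
Hypothesis S_K : steiner_polynomial K S.

(** With L the body of support function p - s |.|, both K + tB and L + (s + t)B
have support function p + t |.|. *)
Lemma inner_steiner : exists2 Q : {poly R},
  steiner_polynomial (wulff K 1 (- s)) Q & S = Q \Po ('X + s%:P).
Proof.
have bL := wulff_convex_body n_ge2 K_C2 e0 curv.
have [f fP] := mixed_volumes bL bB.
pose Q : {poly R} := \poly_(i < n.+1) f`_i.
have QP t : 0 <= t -> volR (mink 1 (wulff K 1 (- s)) t B) = Q.[t].
  move=> t0; rewrite fP ?ler01 ?ltr_wpDr// horner_poly; apply: eq_bigr => i _.
  by rewrite expr1n mulr1.
exists Q => [t t0|]; first by rewrite vol_parallel// QP.
apply: poly_eq_nonneg => t t0; rewrite horner_comp hornerD hornerX hornerC.
rewrite -QP ?addr_ge0//.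
have := S_K t0; rewrite vol_parallel// => -[<-]; congr volR.
apply: support_inj => [||y].
- by apply: mink_convex_body; rewrite ?ler01 ?ltr_wpDr.
- by apply: mink_convex_body; rewrite ?ler01 ?addr_ge0 ?ltr_wpDr ?addr_ge0.
rewrite !support_mink ?ler01 ?ltr_wpDr ?addr_ge0//.
rewrite (support_wulff n_ge2 K_C2 _ e0 curv) (support_ball n_ge2 K_C2) /combined_support; ring.
Qed.

End lower.

Section upper.
Variables (rho e : R) (S : {poly R}).
Hypotheses (rho0 : 0 < rho) (e0 : 0 < e) (curv : curvature_ge K (-1) rho e).
Hypothesis S_K : steiner_polynomial K S.

(** Let L be the body of support function rho |.| - p. Comparing support
functions, K + tB = (1 + t/rho) K + (t/rho) L and L + tB = (t/rho) K + (1 +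
t/rho) L, so both volumes are values of one form of degree n, and t -> - (rho +
t) exchanges its arguments up to a sign. *)
Lemma outer_steiner :
  steiner_polynomial (wulff K (-1) rho) ((-1) ^+ n *: (S \Po (- ('X + rho%:P)))).
Proof.
have bL := wulff_convex_body n_ge2 K_C2 e0 curv; set L := wulff _ _ _ in bL *.
have [f fP] := mixed_volumes bK bL.
pose F : {poly R} := \sum_(i < n.+1)
  (f`_i)%:P * (1%:P + rho^-1 *: 'X) ^+ (n - i) * (rho^-1 *: 'X) ^+ i.
have FE t : F.[t] = \sum_(i < n.+1) f`_i * (1 + t / rho) ^+ (n - i) * (t / rho) ^+ i.
  rewrite horner_sum; apply: eq_bigr => i _.
  by rewrite !hornerM !horner_exp hornerD !hornerC hornerZ hornerX [rho^-1 * t]mulrC.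
have tr t : 0 <= t -> [/\ 0 <= t / rho, 0 <= 1 + t / rho & 0 < 1 + t / rho + t / rho].
  move=> t0; have : 0 <= t / rho by rewrite divr_ge0// ltW.
  by move=> h; split => //; lra.
have suppL y : support_function L y = - p y + rho * nrm y.
  by rewrite (support_wulff n_ge2 K_C2 _ e0 curv) /combined_support mulN1r.
have SE : S = F.
  apply: poly_eq_nonneg => t t0; have [t1 t2 t3] := tr t t0.
  have := S_K t0; rewrite vol_parallel// => -[<-].
  rewrite FE -/(homog_form n f (1 + t / rho) (t / rho)) -fP//; congr volR.
  apply: support_inj => [||y].
  - by apply: mink_convex_body; rewrite ?ler01 ?ltr_wpDr.
  - exact: mink_convex_body.
  rewrite !support_mink ?ler01 ?ltr_wpDr// suppL (support_ball n_ge2 K_C2).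
  by field; rewrite gt_eqF.
move=> t t0; have [t1 t2 t3] := tr t t0.
rewrite vol_parallel//; congr (_%:E).
have t4 : 0 < t / rho + (1 + t / rho) by rewrite addrC.
transitivity (volR (mink (t / rho) K (1 + t / rho) L)).
  congr volR; apply: support_inj => [||y].
  - by apply: mink_convex_body; rewrite ?ler01 ?ltr_wpDr.
  - exact: mink_convex_body.
  rewrite (support_mink y ler01 t0 _ bL bB) ?ltr_wpDr//.
  rewrite (support_mink y t1 t2 t4 bK bL) suppL.
  by rewrite (support_ball n_ge2 K_C2); field; rewrite gt_eqF.
rewrite fP// hornerZ horner_comp hornerN hornerD hornerX hornerC SE FE.
rewrite mulr_sumr; apply: eq_bigr => i _.
have -> : 1 + - (t + rho) / rho = - (t / rho) by field; rewrite gt_eqF.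
have -> : - (t + rho) / rho = - (1 + t / rho) by field; rewrite gt_eqF.
have N1 (a : R) k : (- a) ^+ k = (-1) ^+ k * a ^+ k by exact: exprNn.
rewrite (N1 (t / rho)) (N1 (1 + t / rho)).
have E : (-1) ^+ (n - i) * (-1) ^+ i = (-1) ^+ n :> R by rewrite -exprD subnK// -ltnS.
have E2 : (-1) ^+ n * (-1) ^+ n = 1 :> R by rewrite -exprMn mulrNN mulr1 expr1n.
transitivity ((-1) ^+ n * ((-1) ^+ (n - i) * (-1) ^+ i) *
  (f`_i * (t / rho) ^+ (n - i) * (1 + t / rho) ^+ i)); last by ring.
by rewrite E E2 mul1r.
Qed.

End upper.
End steiner.

(** * Location of the roots *)

Section complex_roots.
Context (R : realType).
Implicit Types (S Q : {poly R}).

Lemma Re_real (a : R) : complex.Re (a%:C)%C = a. Proof. by []. Qed.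

Lemma root_shift S Q (s : R) z : S = Q \Po ('X + s%:P) ->
  root (complex_poly S) z -> root (complex_poly Q) (z + (s%:C)%C).
Proof.
move=> ->; rewrite /root /complex_poly map_comp_poly horner_comp.
by rewrite rmorphD /= map_polyX map_polyC hornerD hornerX hornerC.
Qed.

Lemma root_reflect S n (s : R) z :
  root (complex_poly S) z ->
  root (complex_poly ((-1) ^+ n *: (S \Po (- ('X + s%:P))))) (- z - (s%:C)%C).
Proof.
rewrite /root /complex_poly map_polyZ hornerZ map_comp_poly horner_comp => z0.
rewrite rmorphN rmorphD /= map_polyX map_polyC hornerN hornerD hornerX hornerC.
by rewrite subrK opprK mulf_eq0 z0 orbT.
Qed.

Lemma mem_complex_roots S (zs : seq R[i]) z : complex_roots S zs -> z \in zs ->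
  root (complex_poly S) z.
Proof.
move=> -> zz; rewrite /root hornerZ mulf_eq0 -/(root _ _) root_prod_XsubC zz orbT//.
Qed.

End complex_roots.

Theorem theorem1p2 (R : realType) (n : nat) (n_ge2 : (2 <= n)%N)
  (all_stable : forall (L : set 'rV[R]_n) (S : {poly R}),
     convex_body L -> steiner_polynomial L S -> stable S)
  (K : set 'rV[R]_n) (K_C2 : C2_convex_body K)
  (S : {poly R}) (S_K : steiner_polynomial K S)
  (zs : n.-tuple R[i]) (S_zs : complex_roots S zs)
  (r : n.-tuple R) (r_zs : perm_eq r [seq complex.Re z | z <- zs])
  (r_sorted : sorted <=%R r)
  (rho_min rho_max : R)
  (rho_minP : minimum (principal_radii K) rho_min)
  (rho_maxP : maximum (principal_radii K) rho_max) :
  path <=%R (- rho_max) (rcons r (- rho_min)).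
Proof.
have [_ lb] := rho_minP; have [_ ub] := rho_maxP.
have bK : convex_body K by case: K_C2.
have ReD (u v : R[i]) : complex.Re (u + v) = complex.Re u + complex.Re v.
  by case: u v => [a b] [c d].
have ReN (u : R[i]) : complex.Re (- u) = - complex.Re u by case: u.
have lower z : root (complex_poly S) z -> complex.Re z <= - rho_min.
  move=> Sz; have [m0|m0] := leP rho_min 0.
    have := all_stable K S bK S_K z Sz; lra.
  rewrite lerNr; apply/ler_addgt0Pl => e e0.
  have [se|se] := leP rho_min e; first by have := all_stable K S bK S_K z Sz; lra.
  have curv := curvature_min K_C2 lb (rho_min - e).
  have e0' : 0 < rho_min - (rho_min - e) by rewrite opprB addrC subrK.
  have s0 : 0 <= rho_min - e by rewrite subr_ge0 ltW.
  have [Q QP SQ] := inner_steiner n_ge2 K_C2 s0 e0' curv S_K.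
  have bL := wulff_convex_body n_ge2 K_C2 e0' curv.
  have := all_stable _ Q bL QP _ (root_shift SQ Sz); rewrite ReD Re_real; lra.
have upper z : root (complex_poly S) z -> - rho_max <= complex.Re z.
  move=> Sz; have max0 := rho_max_ge0 n_ge2 K_C2 ub.
  rewrite lerNl; apply/ler_addgt0Pl => e e0.
  have curv := curvature_max K_C2 ub (rho_max + e).
  have e0' : 0 < rho_max + e - rho_max by rewrite addrAC subrr add0r.
  have rho0 : 0 < rho_max + e by rewrite ltr_wpDl.
  have QP := outer_steiner n_ge2 K_C2 rho0 e0' curv S_K.
  have bL := wulff_convex_body n_ge2 K_C2 e0' curv.
  have := all_stable _ _ bL QP _ (root_reflect n (rho_max + e) Sz).
  rewrite ReD !ReN Re_real; lra.
have bounds x : x \in (r : seq R) -> - rho_max <= x <= - rho_min.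
  rewrite (perm_mem r_zs) => /mapP[z zz ->].
  by rewrite upper ?lower// (mem_complex_roots S_zs zz).
rewrite rcons_path (path_sortedE le_trans) r_sorted andbT.
apply/andP; split; first by apply/allP => x /bounds/andP[].
have last_in (s : seq R) x : (0 < size s)%N -> last x s \in s.
  by case: s => [|a s]//= _; exact: mem_last.
have : last (- rho_max) r \in (r : seq R) by apply: last_in; rewrite size_tuple ltnW.
by move=> /bounds/andP[].
Qed.
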